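(* In the setting below (product initial state $\tau=\tau_{AB_1}\otimes\tau_{B_2C}$, four-outcome POVM $\mathscr{B}=(B^b_{B_1B_2})_{b=0}^3$ on $\mathcal{H}_{B_1}\otimes\mathcal{H}_{B_2}$, Hermitian observables $A_0,A_1$ on $\mathcal{H}_A$ and $C_0,C_1$ on $\mathcal{H}_C$ squaring to identity), let $\beta_b:=\operatorname{tr}(W_b\tau^b_{AC})$ for each $b$ with $p_b>0$ and let $\beta_{\mathrm{ave}}:=\sum_{b:\,p_b>0}p_b\beta_b$. Assume $\beta_{\mathrm{ave}}>x^*$. Set $q:=g(\beta_{\mathrm{ave}})$ and $\eta^*:=2\sqrt{q(1-q)}$. Then $$Q(\mathscr{B},\Phi)\;\ge\;\min_{\eta\in[0,\eta^*]}\frac{4\,s(\eta)\,q-t(\eta)}{8(1+\eta^* )},$$ where $s(\eta)=\frac{2}{\sqrt{1-\eta^2}}$ and $t(\eta)=\frac{4}{\sqrt{1-\eta^2}}-\frac{4}{1+\eta}$.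
   Context: All Hilbert spaces finite-dimensional. Bell states on $\mathbb{C}^2\otimes\mathbb{C}^2$: $|\Phi^0\rangle=(|00\rangle+|11\rangle)/\sqrt2$, $|\Phi^1\rangle=(|00\rangle-|11\rangle)/\sqrt2$, $|\Phi^2\rangle=(|01\rangle+|10\rangle)/\sqrt2$, $|\Phi^3\rangle=(|01\rangle-|10\rangle)/\sqrt2$, $\Phi^b:=|\Phi^b\rangle\langle\Phi^b|$, and $\Phi=(\Phi^b)_{b=0}^3$ is the Bell-state measurement on $\mathcal{H}_{B_1'}\otimes\mathcal{H}_{B_2'}=\mathbb{C}^2\otimes\mathbb{C}^2$. $p_b:=\operatorname{tr}[(\mathbb{1}_A\otimes B^b\otimes\mathbb{1}_C)\tau]$, $\tau^b_{AC}:=\frac1{p_b}\operatorname{tr}_{B_1B_2}[(\mathbb{1}_A\otimes B^b\otimes\mathbb{1}_C)\tau]$. Bell operators: $W_0:=A_0 C_0+A_0 C_1+A_1 C_0-A_1 C_1$, $W_1:=A_0 C_0+A_0 C_1-A_1 C_0+A_1 C_1$, $W_2:=-W_1$, $W_3:=-W_0$ (tensor products $A_x\otimes C_z$ implied). $x^*:=(16+14\sqrt2)/17$ and $g(\beta):=\frac12+\frac12\cdot\frac{\beta-x^*}{2\sqrt2-x^*}$. For a real POVM $\mathscr{F}=(F^j_{B_1B_2})_{j=1}^d$ on $\mathcal{H}_{B_1}\otimes\mathcal{H}_{B_2}$ and a projective ideal measurement $\mathscr{P}=(P^j_{B_1'B_2'})_{j=1}^d$ on $\mathcal{H}_{B_1'}\otimes\mathcal{H}_{B_2'}$,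 the quality is $Q(\mathscr{F},\mathscr{P}):=\frac{1}{|B_1'||B_2'|}\max_{\Lambda_{B_1},\Lambda_{B_2}}\sum_{j=1}^d\operatorname{tr}\big[(\Lambda_{B_1}\otimes\Lambda_{B_2})(F^j)\,P^j\big]$, maximized over completely positive unital maps $\Lambda_{B_i}:\mathcal{L}(\mathcal{H}_{B_i})\to\mathcal{L}(\mathcal{H}_{B_i'})$; $|X|$ denotes the dimension of $\mathcal{H}_X$. *)

(* Defs.v *)
(* Complex scalars: an arbitrary numClosedFieldType K
   (e.g. algC); finite-dimensional Hilbert spaces are K^I for finTypes I. *)
From HB Require Import structures.
From mathcomp Require Import all_boot all_order all_algebra.
Set Implicit Arguments. Unset Strict Implicit. Unset Printing Implicit Defensive.
Import Order.TTheory GRing.Theory Num.Theory.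
Local Open Scope ring_scope.

(* Linear operators on K^I, as I x I arrays of entries. *)
Definition op (K : numClosedFieldType) (I : finType) := I -> I -> K.

Definition mulop {K : numClosedFieldType} {I : finType} (X Y : op K I) : op K I :=
  fun i j => \sum_k X i k * Y k j.
Definition idop {K : numClosedFieldType} {I : finType} : op K I :=
  fun i j => (i == j)%:R.
Definition scaleop {K : numClosedFieldType} {I : finType} (c : K) (X : op K I) : op K I :=
  fun i j => c * X i j.
Definition trop {K : numClosedFieldType} {I : finType} (X : op K I) : K :=
  \sum_i X i i.
(* positive semidefinite: <v, X v> >= 0 for all vectors v *)
Definition psd {K : numClosedFieldType} {I : finType} (X : op K I) : Prop :=
  forall v : I -> K, 0 <= \sum_i \sum_j (v i)^* * X i j * v j.
Definition density {K : numClosedFieldType} {I : finType} (X : op K I) : Prop :=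
  psd X /\ trop X = 1.
Definition povm {K : numClosedFieldType} {I J : finType} (F : J -> op K I) : Prop :=
  (forall j, psd (F j)) /\ (forall i i', \sum_j F j i i' = idop i i').
(* Hermitian operator squaring to the identity *)
Definition observable {K : numClosedFieldType} {I : finType} (X : op K I) : Prop :=
  (forall i j, X i j = (X j i)^*) /\ mulop X X = idop.
(* Kronecker / tensor product *)
Definition tens {K : numClosedFieldType} {I1 I2 : finType}
  (X : op K I1) (Y : op K I2) : op K (I1 * I2)%type :=
  fun i j => X i.1 j.1 * Y i.2 j.2.

(* Global system ordered as A (B1 B2) C.
   prod_state t1 t2 = t1_{AB1} (x) t2_{B2C}, with factors reordered to A B1 B2 C. *)
Definition prod_state {K : numClosedFieldType} {A B1 B2 C : finType}
  (t1 : op K (A * B1)%type) (t2 : op K (B2 * C)%type) : op K ((A * (B1 * B2)) * C)%type :=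
  fun i j => t1 (i.1.1, i.1.2.1) (j.1.1, j.1.2.1) * t2 (i.1.2.2, i.2) (j.1.2.2, j.2).
(* 1_A (x) X (x) 1_C *)
Definition embB {K : numClosedFieldType} {A B C : finType} (X : op K B) : op K ((A * B) * C)%type :=
  tens (tens idop X) idop.
(* partial trace over the middle factor *)
Definition ptr_mid {K : numClosedFieldType} {A M C : finType}
  (X : op K ((A * M) * C)%type) : op K (A * C)%type :=
  fun i j => \sum_m X ((i.1, m), i.2) ((j.1, m), j.2).

(* p_b and tau^b_{AC} *)
Definition prob {K : numClosedFieldType} {A B C : finType}
  (tau : op K ((A * B) * C)%type) (Bb : op K B) : K :=
  trop (mulop (embB Bb) tau).
Definition cond_state {K : numClosedFieldType} {A B C : finType}
  (tau : op K ((A * B) * C)%type) (Bb : op K B) : op K (A * C)%type :=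
  scaleop (prob tau Bb)^-1 (ptr_mid (mulop (embB Bb) tau)).

(* Bell operators W_b *)
Definition chsh {K : numClosedFieldType} {A C : finType}
  (A0 A1 : op K A) (C0 C1 : op K C) (s1 s2 s3 s4 : K) : op K (A * C)%type :=
  fun i j => s1 * tens A0 C0 i j + s2 * tens A0 C1 i j
           + s3 * tens A1 C0 i j + s4 * tens A1 C1 i j.
Definition Wop {K : numClosedFieldType} {A C : finType}
  (A0 A1 : op K A) (C0 C1 : op K C) (b : 'I_4) : op K (A * C)%type :=
  match val b with
  | 0%N => chsh A0 A1 C0 C1 1 1 1 (-1)
  | 1%N => chsh A0 A1 C0 C1 1 1 (-1) 1
  | 2%N => chsh A0 A1 C0 C1 (-1) (-1) 1 (-1)   (* W_2 = - W_1 *)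
  | _ => chsh A0 A1 C0 C1 (-1) (-1) (-1) 1      (* W_3 = - W_0 *)
  end.

(* beta_ave = sum_{b : p_b > 0} p_b tr(W_b tau^b_AC) *)
Definition beta_ave {K : numClosedFieldType} {A B C : finType}
  (tau : op K ((A * B) * C)%type) (Bm : 'I_4 -> op K B)
  (A0 A1 : op K A) (C0 C1 : op K C) : K :=
  \sum_(b < 4 | 0 < prob tau (Bm b))
     prob tau (Bm b) * trop (mulop (Wop A0 A1 C0 C1 b) (cond_state tau (Bm b))).

Definition xstar {K : numClosedFieldType} : K := (16 + 14 * sqrtC 2) / 17.
Definition gfun {K : numClosedFieldType} (beta : K) : K :=
  1 / 2 + 1 / 2 * ((beta - xstar) / (2 * sqrtC 2 - xstar)).
Definition sfun {K : numClosedFieldType} (eta : K) : K := 2 / sqrtC (1 - eta ^+ 2).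
Definition tfun {K : numClosedFieldType} (eta : K) : K :=
  4 / sqrtC (1 - eta ^+ 2) - 4 / (1 + eta).

(* Bell states on C^2 (x) C^2, with |0> = false, |1> = true *)
Definition bell_amp {K : numClosedFieldType} (b : 'I_4) (x : bool * bool) : K :=
  let r := (sqrtC (2 : K))^-1 in
  match val b, x with
  | 0%N, (false, false) => r | 0%N, (true, true) => r
  | 1%N, (false, false) => r | 1%N, (true, true) => - r
  | 2%N, (false, true) => r  | 2%N, (true, false) => r
  | 3%N, (false, true) => r  | 3%N, (true, false) => - r
  | _, _ => 0
  end.
Definition bell {K : numClosedFieldType} (b : 'I_4) : op K (bool * bool)%type :=
  fun x y => bell_amp b x * (bell_amp b y)^*.

(* Completely positive unital maps L(K^I) -> L(K^J) *)
Definition linear_map {K : numClosedFieldType} {I J : finType} (L : op K I -> op K J) : Prop :=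
  forall (a : K) (X Y : op K I),
    L (fun i j => a * X i j + Y i j) = (fun i j => a * L X i j + L Y i j).
(* id_k (x) L *)
Definition ampl {K : numClosedFieldType} {I J : finType} (k : nat) (L : op K I -> op K J)
  (X : op K ('I_k * I)%type) : op K ('I_k * J)%type :=
  fun x y => L (fun u v => X (x.1, u) (y.1, v)) x.2 y.2.
Definition cp_map {K : numClosedFieldType} {I J : finType} (L : op K I -> op K J) : Prop :=
  linear_map L /\ forall (k : nat) (X : op K ('I_k * I)%type), psd X -> psd (ampl L X).
Definition unital {K : numClosedFieldType} {I J : finType} (L : op K I -> op K J) : Prop :=
  L idop = idop.
(* L1 (x) L2 = (id (x) L2) o (L1 (x) id) *)
Definition tens_map {K : numClosedFieldType} {I1 I2 J1 J2 : finType}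
  (L1 : op K I1 -> op K J1) (L2 : op K I2 -> op K J2)
  (X : op K (I1 * I2)%type) : op K (J1 * J2)%type :=
  fun x y => L2 (fun u v => L1 (fun s t => X (s, u) (t, v)) x.1 y.1) x.2 y.2.

(* the quantity maximised in Q(F,P), normalised by 1/(|B1'||B2'|) *)
Definition quality_val {K : numClosedFieldType} {B1 B2 B1' B2' J : finType}
  (F : J -> op K (B1 * B2)%type) (P : J -> op K (B1' * B2')%type)
  (L1 : op K B1 -> op K B1') (L2 : op K B2 -> op K B2') : K :=
  (#|B1'|%:R * #|B2'|%:R)^-1 * \sum_j trop (mulop (tens_map L1 L2 (F j)) (P j)).
(* Q(F,P) >= v, where Q(F,P) is the (attained) maximum of quality_val over
   pairs of CP unital maps *)
Definition quality_ge {K : numClosedFieldType} {B1 B2 B1' B2' J : finType}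
  (F : J -> op K (B1 * B2)%type) (P : J -> op K (B1' * B2')%type) (v : K) : Prop :=
  exists (L1 : op K B1 -> op K B1') (L2 : op K B2 -> op K B2'),
    cp_map L1 /\ unital L1 /\ cp_map L2 /\ unital L2 /\ v <= quality_val F P L1 L2.

(* Main.v *)
Require Import Defs.
From HB Require Import structures.
From mathcomp Require Import all_boot all_order all_algebra.
From mathcomp Require Import ring lra spectral sesquilinear.
From Stdlib Require Import FunctionalExtensionality.
Set Implicit Arguments. Unset Strict Implicit. Unset Printing Implicit Defensive.
Import Order.TTheory GRing.Theory Num.Theory.
Local Open Scope ring_scope.

(* On every joint eigenspace of [A0 A1 + A1 A0] the two observables of a party generate a
   qubit (Jordan's lemma), and dephasing that qubit with an angle-dependent strength gives
   local channels for which the pulled back Bell projector dominates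
   [s W_b + mu] with [s = (4 + 5 sqrt 2) / 16] and [mu = - (1 + 2 sqrt 2) / 4]
   (Kaniewski's operator inequality).  In the Bell basis this inequality splits into two
   2 x 2 blocks whose determinants are polynomials in the two dephasing strengths that are
   nonnegative on the unit square.  Hence replacing the outer parties by qubits yields
   [sum_b p_b <Phi^b|tau^b|Phi^b> >= s beta_ave + mu = q].

   If the two reduced qubit states were maximally mixed, the two sources would be Choi
   states of unital maps achieving quality [q].  In general their spectral gaps are at most
   [eta* = 2 sqrt (q (1 - q))]; one side is corrected by conjugation with the inverse
   square root of its marginal, which costs [s(eta)] and [t(eta)], the other one by adding
   noise, which costs the factor [2 / (1 + eta* )]. *)

(** * Real scalars *)

(** The slope and the constant of the operator inequality are those of [gfun]: the affine function
    takes the value 1 at 2 sqrt 2 and 1/2 at x*. Exceeding 1/2 is what the second half needs. A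
    state whose marginal has eigenvalues a, b overlaps a maximally entangled vector by at most (sqrt
    a + sqrt b)^2 / 2 = 1/2 + sqrt (a b). So q > 1/2 makes both marginals invertible and gives (2 q
    - 1)^2 <= 4 a b, which says that the gap a - b is at most eta*. The obstacle is unitality: a
    source is the Choi operator of a unital map only if its marginal is the identity. The inverse
    square root on the A side weights the two spectral components of each amplitude by u = 1 / sqrt
    a and v = 1 / sqrt b, where u v = s(eta) and u^2 = 2 / (1 + eta). The noise on the C side only
    adds a nonnegative term, so it leaves the estimate on the A side intact. The witness for eta is
    the actual gap of the A marginal, about which only the bound by eta* is known; hence the
    minimum. *)

Section RealSubfield.
Variable K : numFieldType.

(** The order of a closed field is partial, so [lra] and the lemmas on real fields do not apply to
    it. They apply to its subfield of real elements, and results return to [K] along [rval]. *)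
Record realK := RealK { rval :> K ; rvalP : rval \is Num.real }.
HB.instance Definition _ := [isSub for rval].
HB.instance Definition _ := [Choice of realK by <:].
HB.instance Definition _ := [SubChoice_isSubIntegralDomain of realK by <:].
HB.instance Definition _ := [SubIntegralDomain_isSubField of realK by <:].

Let leK (x y : realK) := rval x <= rval y.
Let ltK (x y : realK) := rval x < rval y.
Let normK (x : realK) := RealK (normr_real (rval x)).

Fact le0_addK x y : leK 0 x -> leK 0 y -> leK 0 (x + y).
Proof. exact: addr_ge0. Qed.
Fact le0_mulK x y : leK 0 x -> leK 0 y -> leK 0 (x * y).
Proof. exact: mulr_ge0. Qed.
Fact le0_antiK x : leK 0 x -> leK x 0 -> x = 0.
Proof. by move=> h1 h2; apply/val_inj/le_anti/andP. Qed.
Fact sub_ge0K x y : leK 0 (y - x) = leK x y.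
Proof. exact: subr_ge0. Qed.
Fact le0_totalK x : leK 0 x || leK x 0.
Proof. exact: rvalP. Qed.
Fact normNK x : normK (- x) = normK x.
Proof. by apply/val_inj; rewrite /= normrN. Qed.
Fact ge0_normK x : leK 0 x -> normK x = x.
Proof. by move=> h; apply/val_inj; rewrite /= ger0_norm. Qed.
Fact lt_defK x y : ltK x y = (y != x) && leK x y.
Proof. by rewrite /ltK lt_def. Qed.

HB.instance Definition _ := Num.IntegralDomain_isLeReal.Build realK
  le0_addK le0_mulK le0_antiK sub_ge0K le0_totalK normNK ge0_normK lt_defK.

HB.instance Definition _ := GRing.isZmodMorphism.Build realK K rval (fun _ _ => erefl).
HB.instance Definition _ := GRing.isMonoidMorphism.Build realK K rval (erefl, fun _ _ => erefl).

Lemma realK_ex (x : K) : x \is Num.real -> exists y : realK, rval y = x.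
Proof. by move=> h; exists (RealK h). Qed.

Lemma rval_inj : injective rval. Proof. exact: val_inj. Qed.

Lemma rval_le (x y : realK) : (rval x <= rval y) = (x <= y). Proof. by []. Qed.

End RealSubfield.

(** * Polynomial inequalities for the dephasing strengths *)

(** Meant for Bernstein forms, whose coefficients are affine in [r] and get their signs from 1.41 <=
    r <= 1.42. *)
Ltac nonneg := lazymatch goal with
  | |- is_true (0 <= _ * _) => apply: mulr_ge0; nonneg
  | |- is_true (0 <= _ ^+ _) => first [ apply: exprn_ge0; assumption | apply: sqr_ge0 ]
  | |- is_true (0 <= _ + - _) => first [ assumption
      | match goal with h1 : is_true (_ <= ?r), h2 : is_true (?r <= 142 / 100) |- _ =>
          move: h1 h2; clear; move=> *; lra end ]
  | |- is_true (0 <= _ + _) => first [ assumption | apply: addr_ge0; nonneg ]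
  | |- is_true (0 <= _%:R) => exact: ler0n
  | _ => assumption
  end.

Lemma sqrt2_bounds (R : realFieldType) (r : R) :
  0 <= r -> r ^+ 2 = 2 -> 141 / 100 <= r <= 142 / 100.
Proof.
move=> r_ge0 r_sqr.
have e : r * r = 2 by rewrite -expr2.
apply/andP; split; rewrite leNgt; apply/negP => h.
  by have := ltr_pM r_ge0 r_ge0 h h; rewrite e; lra.
have h0 : 0 <= 142 / 100 :> R by lra.
by have := ltr_pM h0 h0 h h; rewrite e; lra.
Qed.

(** In the application t is sqrt 2 |sin| and g the visibility. The square root is replaced by a
    polynomial with an error of order g^3 at g = 0, where the determinants degenerate; the
    difference of the squares is 1 - g times a Bernstein form. *)
Lemma sine_lower (R : realFieldType) (r g t : R) :
  0 <= r -> r ^+ 2 = 2 -> 0 <= g <= 1 -> 0 <= t ->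
  t ^+ 2 = (1 - g) * (1 + (r - 1) ^+ 2 * g) ->
  (1 - g) * (1 + (2 - r) * g + (r - 1) * g ^+ 2) <= t.
Proof.
move=> r_ge0 r_sqr /andP[g0 g1] t0 tE; have /andP[r1 r2] := sqrt2_bounds r_ge0 r_sqr.
have p0 : 0 <= 1 - g by lra.
set l := (X in X <= t).
have l0 : 0 <= l by rewrite mulr_ge0 // !addr_ge0 ?mulr_ge0 ?exprn_ge0 //; lra.
rewrite -(ler_pXn2r (n := 2)) ?nnegrE // -subr_ge0 tE.
have -> : (1 - g) * (1 + (r - 1) ^+ 2 * g) - l ^+ 2 = (1 - g) *
   ((12 - 8 * r) * (g ^+ 3 * (1 - g) ^+ 2) + (13 - 8 * r) * (g ^+ 4 * (1 - g))
    + (4 - 2 * r) * g ^+ 5).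
  by rewrite /l; ring: r_sqr.
by rewrite mulr_ge0 // !addr_ge0 ?mulr_ge0 ?exprn_ge0 //; lra.
Qed.

(* Both determinants vanish to second order at [g = h = 0] and the first one
   also vanishes at [g = h = 1]; elsewhere the Bernstein coefficients decide. *)
Lemma even_sector_det (R : realFieldType) (r g h s t : R)
    (c := 1 + (r - 1) * g) (d := 1 + (r - 1) * h) :
  0 <= r -> r ^+ 2 = 2 -> 0 <= g <= 1 -> 0 <= h <= 1 -> 0 <= s -> 0 <= t ->
  s ^+ 2 = (1 - g) * (1 + (r - 1) ^+ 2 * g) ->
  t ^+ 2 = (1 - h) * (1 + (r - 1) ^+ 2 * h) ->
  ((1 - g) * (1 - h) - (2 * r + 5) * (s * t)) ^+ 2 <=
  (2 * (1 + g) * (1 + h) + (1 - g) * (1 - h) - (2 * r + 5) * (c * d) + 2 + 4 * r) *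
  ((1 - g) * (1 - h) + (2 * r + 5) * (c * d) + 2 + 4 * r).
Proof.
move=> r_ge0 r_sqr g01 h01 s_ge0 t_ge0 s_sqr t_sqr.
have /andP[r1 r2] := sqrt2_bounds r_ge0 r_sqr.
have /andP[g0 g1] := g01; have /andP[h0 h1] := h01.
have p0 : 0 <= 1 - g by lra.
have m0 : 0 <= 1 - h by lra.
pose l := (1 - g) * (1 + (2 - r) * g); pose k := (1 - h) * (1 + (2 - r) * h).
have l0 : 0 <= l by rewrite mulr_ge0 // !addr_ge0 ?mulr_ge0 //; lra.
have k0 : 0 <= k by rewrite mulr_ge0 // !addr_ge0 ?mulr_ge0 //; lra.
have ls : l <= s.
  apply: le_trans (sine_lower r_ge0 r_sqr g01 s_ge0 s_sqr).
  by rewrite ler_wpM2l // lerDl mulr_ge0 ?exprn_ge0 //; lra.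
have kt : k <= t.
  apply: le_trans (sine_lower r_ge0 r_sqr h01 t_ge0 t_sqr).
  by rewrite ler_wpM2l // lerDl mulr_ge0 ?exprn_ge0 //; lra.
(* Once [s ^+ 2] and [t ^+ 2] are eliminated, s t enters linearly with a nonnegative factor, so a
   polynomial lower bound on it suffices. *)
have stl : 0 <= s * t - l * k by rewrite subr_ge0 ler_pM.
rewrite -subr_ge0.
have -> : (2 * (1 + g) * (1 + h) + (1 - g) * (1 - h) - (2 * r + 5) * (c * d) + 2 + 4 * r) *
  ((1 - g) * (1 - h) + (2 * r + 5) * (c * d) + 2 + 4 * r) -
  ((1 - g) * (1 - h) - (2 * r + 5) * (s * t)) ^+ 2 =
  2 * (2 * r + 5) * ((1 - g) * (1 - h)) * (s * t - l * k) +
  ((14 * r - 18) * ((1 - g) ^+ 3 * h ^+ 2 * (1 - h) + g ^+ 2 * (1 - g) * (1 - h) ^+ 3)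
 + (12 * r - 6) * ((1 - g) ^+ 3 * h ^+ 3 + g ^+ 3 * (1 - h) ^+ 3)
 + (80 * r - 104) * (g * (1 - g) ^+ 2 * h * (1 - h) ^+ 2)
 + (114 * r - 142) * (g * (1 - g) ^+ 2 * h ^+ 2 * (1 - h) + g ^+ 2 * (1 - g) * h * (1 - h) ^+ 2)
 + (2 + 16 * r) * (g * (1 - g) ^+ 2 * h ^+ 3 + g ^+ 3 * h * (1 - h) ^+ 2)
 + (104 * r - 116) * (g ^+ 2 * (1 - g) * h ^+ 2 * (1 - h))
 + (8 + 4 * r) * (g ^+ 2 * (1 - g) * h ^+ 3 + g ^+ 3 * h ^+ 2 * (1 - h))).
  by rewrite /c /d /l /k; ring: r_sqr s_sqr t_sqr.
by nonneg.
Qed.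

Lemma odd_sector_det (R : realFieldType) (r g h s t : R)
    (c := 1 + (r - 1) * g) (d := 1 + (r - 1) * h) :
  0 <= r -> r ^+ 2 = 2 -> 0 <= g <= 1 -> 0 <= h <= 1 -> 0 <= s -> 0 <= t ->
  s ^+ 2 = (1 - g) * (1 + (r - 1) ^+ 2 * g) ->
  t ^+ 2 = (1 - h) * (1 + (r - 1) ^+ 2 * h) ->
  ((1 - g) * (1 + h) - (2 * r + 5) * (s * d)) ^+ 2 <=
  ((1 - g) * (1 + h) + 2 * (1 + g) * (1 - h) - (2 * r + 5) * (c * t) + 2 + 4 * r) *
  ((1 - g) * (1 + h) + (2 * r + 5) * (c * t) + 2 + 4 * r).
Proof.
move=> r_ge0 r_sqr g01 h01 s_ge0 t_ge0 s_sqr t_sqr.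
have /andP[r1 r2] := sqrt2_bounds r_ge0 r_sqr.
have /andP[g0 g1] := g01; have /andP[h0 h1] := h01.
have p0 : 0 <= 1 - g by lra.
have m0 : 0 <= 1 - h by lra.
have e0 : 0 <= 1 + g by lra.
have f0 : 0 <= 1 + h by lra.
have c0 : 0 <= c by rewrite addr_ge0 ?mulr_ge0 //; lra.
have d0 : 0 <= d by rewrite addr_ge0 ?mulr_ge0 //; lra.
pose l := (1 - g) * (1 + (2 - r) * g + (r - 1) * g ^+ 2).
pose k := (1 - h) * (1 + (2 - r) * h + (r - 1) * h ^+ 2).
have sl : 0 <= s - l by rewrite subr_ge0; apply: sine_lower.
have tk : 0 <= t - k by rewrite subr_ge0; apply: sine_lower.
rewrite -subr_ge0.
(* At second order the mixed Bernstein coefficient is 104 - 80 r, which is negative; this is why the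
   square of g (1 - h) - h (1 - g) is split off. *)
have -> : ((1 - g) * (1 + h) + 2 * (1 + g) * (1 - h) - (2 * r + 5) * (c * t) + 2 + 4 * r) *
  ((1 - g) * (1 + h) + (2 * r + 5) * (c * t) + 2 + 4 * r) -
  ((1 - g) * (1 + h) - (2 * r + 5) * (s * d)) ^+ 2 =
  2 * (2 * r + 5) * (c * ((1 + g) * (1 - h)) * (t - k) + d * ((1 - g) * (1 + h)) * (s - l)) +
  ((1 - g) ^+ 2 * (1 - h) ^+ 2 *
    ((20 * r - 20) * (g * (1 - h) - h * (1 - g)) ^+ 2 +
     (64 - 40 * r) * (g * (1 - h) * (h * (1 - g))))
 + (26 * r - 24) * ((1 - g) ^+ 4 * h ^+ 3 * (1 - h) + g ^+ 3 * (1 - g) * (1 - h) ^+ 4)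
 + (12 * r - 6) * ((1 - g) ^+ 4 * h ^+ 4 + g ^+ 4 * (1 - h) ^+ 4)
 + (124 - 74 * r) * (g * (1 - g) ^+ 3 * h ^+ 2 * (1 - h) ^+ 2
                     + g ^+ 2 * (1 - g) ^+ 2 * h * (1 - h) ^+ 3)
 + (52 * r - 28) * (g * (1 - g) ^+ 3 * h ^+ 3 * (1 - h) + g ^+ 3 * (1 - g) * h * (1 - h) ^+ 3)
 + (68 * r - 44) * (g * (1 - g) ^+ 3 * h ^+ 4 + g ^+ 4 * h * (1 - h) ^+ 3)
 + (300 - 136 * r) * (g ^+ 2 * (1 - g) ^+ 2 * h ^+ 2 * (1 - h) ^+ 2)
 + (116 + 24 * r) * (g ^+ 2 * (1 - g) ^+ 2 * h ^+ 3 * (1 - h)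
                     + g ^+ 3 * (1 - g) * h ^+ 2 * (1 - h) ^+ 2)
 + (88 * r - 2) * (g ^+ 2 * (1 - g) ^+ 2 * h ^+ 4 + g ^+ 4 * h ^+ 2 * (1 - h) ^+ 2)
 + (112 + 48 * r) * (g ^+ 3 * (1 - g) * h ^+ 3 * (1 - h))
 + (48 + 52 * r) * (g ^+ 3 * (1 - g) * h ^+ 4 + g ^+ 4 * h ^+ 3 * (1 - h))
 + (36 + 16 * r) * (g ^+ 4 * h ^+ 4)).
  by rewrite /c /d /l /k; ring: r_sqr s_sqr t_sqr.
by nonneg.
Qed.

(** * The operator inequality in one pair of qubit blocks *)

Section Pointwise.
Variable K : numClosedFieldType.
Local Notation r := (sqrtC (2 : K)).

Lemma hermitian_form2_ge0 (a b d x y : K) : a \is Num.real -> b \is Num.real ->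
  0 < d -> b ^+ 2 <= a * d ->
  0 <= a * (x * x^*) + b * (x * y^* + y * x^*) + d * (y * y^*).
Proof.
move=> ra rb d0 ad; rewrite -(pmulr_rge0 _ d0).
have -> : d * (a * (x * x^*) + b * (x * y^* + y * x^*) + d * (y * y^*)) =
  (a * d - b ^+ 2) * (x * x^*) + (b * x + d * y) * (b * x + d * y)^*.
  rewrite rmorphD !rmorphM /= (CrealP rb) (CrealP (gtr0_real d0)); ring.
by rewrite addr_ge0 ?mul_conjC_ge0 // mulr_ge0 ?mul_conjC_ge0 ?subr_ge0.
Qed.

(* [xz x z] is [x sigma_x + z sigma_z]. *)
Definition xz (x z : K) : op K bool :=
  fun i j => if i == j then (if i then - z else z) else x.

(* With [c = cos (pi/4 - a)], where [2 a] is the angle between the two observables of a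
   block, this is Kaniewski's [(1 + sqrt 2) (sin a + cos a - 1)]. *)
Definition visibility (c : K) : K := (1 + r) * (r * c - 1).

Lemma sqrt2_ge0 : 0 <= r. Proof. by rewrite sqrtC_ge0 ler0n. Qed.
Lemma sqrt2_sqr : r ^+ 2 = 2. Proof. exact: sqrtCK. Qed.

(** Cosine and sine of an angle between - pi/4 and pi/4. *)
Definition angle (c s : K) : Prop :=
  [/\ c \is Num.real, s \is Num.real, `|s| <= c & c ^+ 2 + s ^+ 2 = 1].

(** The visibility maps the range [1 / sqrt 2, 1] of c affinely onto [0, 1]; the upper end is (1 +
    sqrt 2) (sqrt 2 - 1) = 1. *)
Lemma visibility_bounds c s : angle c s -> 0 <= visibility c <= 1.
Proof.
case=> /realK_ex[c0 <-] /realK_ex[s0 <-] sc e.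
have [r0 r0E] := realK_ex (ger0_real sqrt2_ge0).
have r00 : 0 <= r0 by rewrite -rval_le r0E sqrt2_ge0.
have r02 : r0 ^+ 2 = 2 by apply: rval_inj; rewrite rmorphXn /= r0E sqrt2_sqr.
have e0 : c0 ^+ 2 + s0 ^+ 2 = 1 by apply: rval_inj; exact: e.
have {}sc : `|s0| <= c0 := sc.
have c00 : 0 <= c0 := le_trans (normr_ge0 _) sc.
rewrite /visibility -r0E.
change (0 <= (1 + r0) * (r0 * c0 - 1) <= 1).
have s2 : s0 ^+ 2 <= c0 ^+ 2 by rewrite -[s0 ^+ 2]real_normK ?num_real // ler_pXn2r ?nnegrE.
have := sqr_ge0 s0 => s20.
have r1c : 1 <= r0 * c0.
  by rewrite -(ler_pXn2r (n := 2)) ?nnegrE ?mulr_ge0 ?ler01 // expr1n exprMn r02; lra.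
have c1 : c0 <= 1 by rewrite -(ler_pXn2r (n := 2)) ?nnegrE ?expr1n ?ler01 //; lra.
apply/andP; split; first by rewrite mulr_ge0 ?subr_ge0 // addr_ge0 ?ler01.
rewrite [leRHS](_ : 1 = (1 + r0) * (r0 - 1)); last by ring: r02.
rewrite ler_wpM2l ?addr_ge0 ?ler01 // lerB //.
by rewrite -[leRHS]mulr1 ler_wpM2l.
Qed.

Lemma sqrt2_real : exists2 r0 : realK K, rval r0 = r & 0 <= r0 /\ r0 ^+ 2 = 2.
Proof.
have [r0 r0E] := realK_ex (ger0_real sqrt2_ge0); exists r0 => //.
split; first by rewrite -rval_le r0E sqrt2_ge0.
by apply: rval_inj; rewrite rmorphXn /= r0E sqrt2_sqr.
Qed.

(** In terms of the visibility g, sqrt 2 c = 1 + (sqrt 2 - 1) g, and sqrt 2 |s| is the square root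
    in the polynomial inequalities; each factor 2 is a product of two such sqrt 2. *)
Lemma sector_dets c s d t (g := visibility c) (h := visibility d) :
  angle c s -> angle d t ->
  ((1 - g) * (1 - h) - (2 * r + 5) * (2 * `|s| * `|t|)) ^+ 2 <=
  (2 * (1 + g) * (1 + h) + (1 - g) * (1 - h) - (2 * r + 5) * (2 * c * d) + 2 + 4 * r) *
  ((1 - g) * (1 - h) + (2 * r + 5) * (2 * c * d) + 2 + 4 * r) /\
  ((1 - g) * (1 + h) - (2 * r + 5) * (2 * `|s| * d)) ^+ 2 <=
  ((1 - g) * (1 + h) + 2 * (1 + g) * (1 - h) - (2 * r + 5) * (2 * c * `|t|) + 2 + 4 * r) *
  ((1 - g) * (1 + h) + (2 * r + 5) * (2 * c * `|t|) + 2 + 4 * r).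
Proof.
rewrite /g /h /visibility {g h} => acs adt.
have := visibility_bounds adt; have := visibility_bounds acs; rewrite /visibility.
case: acs => /realK_ex[c0 <-] /realK_ex[s0 <-] sc ecs.
case: adt => /realK_ex[d0 <-] /realK_ex[t0 <-] td edt.
have [r0 r0E [r00 r02]] := sqrt2_real; rewrite -r0E.
pose g0 := (1 + r0) * (r0 * c0 - 1); pose h0 := (1 + r0) * (r0 * d0 - 1).
move=> g01 h01.
have {}ecs : c0 ^+ 2 + s0 ^+ 2 = 1 by apply: rval_inj; exact: ecs.
have {}edt : d0 ^+ 2 + t0 ^+ 2 = 1 by apply: rval_inj; exact: edt.
have es : (r0 * `|s0|) ^+ 2 = (1 - g0) * (1 + (r0 - 1) ^+ 2 * g0).
  rewrite exprMn real_normK ?num_real //.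
  have -> : s0 ^+ 2 = 1 - c0 ^+ 2 by rewrite -ecs addrC addKr.
  by rewrite /g0; ring: r02.
have et : (r0 * `|t0|) ^+ 2 = (1 - h0) * (1 + (r0 - 1) ^+ 2 * h0).
  rewrite exprMn real_normK ?num_real //.
  have -> : t0 ^+ 2 = 1 - d0 ^+ 2 by rewrite -edt addrC addKr.
  by rewrite /h0; ring: r02.
have s1 := mulr_ge0 r00 (normr_ge0 s0); have t1 := mulr_ge0 r00 (normr_ge0 t0).
have := @odd_sector_det _ r0 g0 h0 _ _ r00 r02 g01 h01 s1 t1 es et.
have := @even_sector_det _ r0 g0 h0 _ _ r00 r02 g01 h01 s1 t1 es et.
have -> : 1 + (r0 - 1) * g0 = r0 * c0 by rewrite /g0; ring: r02.
have -> : 1 + (r0 - 1) * h0 = r0 * d0 by rewrite /h0; ring: r02.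
have E x y : r0 * x * (r0 * y) = 2 * x * y :> realK K by ring: r02.
by rewrite !E => e1 e2; split; [exact: e1 | exact: e2].
Qed.

Definition overlap (b : 'I_4) (M M' y : bool -> bool -> K) : K :=
  \sum_i \sum_c (bell_amp b (i, c))^* * \sum_j \sum_d M i j * M' c d * y j d.

(** The value at 0 is 1, so that the square is always 1 and the dephasing axis built from it is a
    unit vector. *)
Definition sign_of (s : K) : K := if 0 <= s then 1 else -1.

Lemma sign_ofP s : s \is Num.real -> s = sign_of s * `|s| /\ sign_of s ^+ 2 = 1.
Proof.
move=> rs; rewrite /sign_of; case: ifPn => [s0|].
  by rewrite mul1r ger0_norm // expr1n.
rewrite -real_ltNge ?real0 // => s0; split; last by ring.
by rewrite ltr0_norm // mulN1r opprK.
Qed.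

Lemma sign_of_real s : sign_of s \is Num.real.
Proof. by rewrite /sign_of; case: ifP; rewrite ?rpredN real1. Qed.

Ltac isreal := repeat first
  [ assumption | exact: normr_real | exact: sign_of_real | exact: real1 | exact: realn
  | rewrite realN | apply: realM | apply: realB | apply: realD ].

(** Dephasing along a bisector of the block observables s sigma_x + c sigma_z and c sigma_x + s
    sigma_z: sigma_z + sigma_x for s >= 0, sigma_z - sigma_x for s < 0. At |s| = c, where the
    visibility is 0, both observables equal this axis up to sign and are left invariant. *)
Definition krausA (c s : K) (k : bool) : bool -> bool -> K :=
  if k then fun i j => sqrtC ((1 - visibility c) / 2) * xz (sign_of s / r) (1 / r) i j
  else fun i j => sqrtC ((1 + visibility c) / 2) * idop i j.

(** The frame of this party is rotated by pi/4, so the bisectors are sigma_z and sigma_x. *)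
Definition krausC (d t : K) (k : bool) : bool -> bool -> K :=
  if k then fun i j => sqrtC ((1 - visibility d) / 2) *
                       (if 0 <= t then xz 0 1 else xz 1 0) i j
  else fun i j => sqrtC ((1 + visibility d) / 2) * idop i j.

(** Both sides couple only x0 with x3 and x1 with x2, so 8 times the difference is a sum of two 2 x
    2 hermitian forms with one positive diagonal entry each; their determinants decide. For t < 0
    the roles of x1 and x2 are exchanged. *)
Lemma dephased_bell_ge c s d t (x0 x1 x2 x3 : K) (g := visibility c) (h := visibility d)
    (e := sign_of s) :
  angle c s -> angle d t ->
  (4 + 5 * r) / 16 * (2 * r * (c * d * (x0 * x0^* - x3 * x3^*)
      - s * t * (x0 * x3^* + x3 * x0^*)
      + c * t * (x1 * x1^* - x2 * x2^*) + s * d * (x1 * x2^* + x2 * x1^*)))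
    - (1 + 2 * r) / 4 * (x0 * x0^* + x1 * x1^* + x2 * x2^* + x3 * x3^*) <=
  (1 + g) * (1 + h) / 4 * (x0 * x0^*)
  + (1 - g) * (1 + h) / 8 * ((x1 + e * x2) * (x1 + e * x2)^*)
  + (1 + g) * (1 - h) / 4 * (if 0 <= t then x1 * x1^* else x2 * x2^*)
  + (1 - g) * (1 - h) / 8 * (if 0 <= t then (x0 - e * x3) * (x0 - e * x3)^*
                             else (x3 + e * x0) * (x3 + e * x0)^*).
Proof.
move=> acs adt; have [d1 d2] := sector_dets acs adt.
have /andP[g0 g1] := visibility_bounds acs; have /andP[h0 h1] := visibility_bounds adt.
have [rc rs sc ecs] := acs; have [rd rt td edt] := adt.
have c0 : 0 <= c := le_trans (normr_ge0 _) sc.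
have d0 : 0 <= d := le_trans (normr_ge0 _) td.
rewrite -/g -/h in d1 d2 g0 g1 h0 h1.
have rr := ger0_real sqrt2_ge0; have rg := ger0_real g0; have rh := ger0_real h0.
have [es e2] := sign_ofP rs; have re : e^* = e by apply/CrealP/sign_of_real.
have [et f2] := sign_ofP rt; rewrite -/e in es e2; set f := sign_of t in et f2.
have rf : f \is Num.real by apply/sign_of_real.
have ree : e \is Num.real by apply/sign_of_real.
pose w := 2 * r + 5; have w0 : 0 <= w by rewrite addr_ge0 ?mulr_ge0 ?sqrtC_ge0 ?ler0n.
have rw := ger0_real w0.
have u0 : 0 < 2 + 4 * r by rewrite ltr_wpDr ?ltr0n // mulr_ge0 ?sqrtC_ge0 ?ler0n.
pose A1 := 2 * (1 + g) * (1 + h) + (1 - g) * (1 - h) - w * (2 * c * d) + (2 + 4 * r).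
pose D1 := (1 - g) * (1 - h) + w * (2 * c * d) + (2 + 4 * r).
pose B1 := (1 - g) * (1 - h) - w * (2 * `|s| * `|t|).
pose A2 := (1 - g) * (1 + h) + 2 * (1 + g) * (1 - h) - w * (2 * c * `|t|) + (2 + 4 * r).
pose D2 := (1 - g) * (1 + h) + w * (2 * c * `|t|) + (2 + 4 * r).
pose B2 := (1 - g) * (1 + h) - w * (2 * `|s| * d).
have {}d1 : B1 ^+ 2 <= A1 * D1 by rewrite /A1 /D1 ![_ + (2 + _)]addrA.
have {}d2 : B2 ^+ 2 <= A2 * D2 by rewrite /A2 /D2 ![_ + (2 + _)]addrA.
have D1p : 0 < D1.
  by rewrite ltr_wpDl // addr_ge0 // !mulr_ge0 ?subr_ge0 ?ler0n.
have D2p : 0 < D2.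
  by rewrite ltr_wpDl // addr_ge0 // !mulr_ge0 ?subr_ge0 // ?addr_ge0 ?ler0n ?ler01 ?normr_ge0.
have rA1 : A1 \is Num.real by isreal.
have rA2 : A2 \is Num.real by isreal.
have rB1 : - e * f * B1 \is Num.real by rewrite !mulNr; isreal.
have rB2 : e * B2 \is Num.real by isreal.
have {}d1 : (- e * f * B1) ^+ 2 <= A1 * D1 by rewrite !exprMn sqrrN e2 f2 !mul1r.
have {}d2 : (e * B2) ^+ 2 <= A2 * D2 by rewrite !exprMn e2 !mul1r.
have F1 := hermitian_form2_ge0 x0 x3 rA1 rB1 D1p d1.
have F2 x y := hermitian_form2_ge0 x y rA2 rB2 D2p d2.
have r2 := sqrt2_sqr.
rewrite -subr_ge0 -(pmulr_rge0 _ (ltr0n K 8 : 0 < 8)).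
rewrite /A1 /D1 /B1 /A2 /D2 /B2 /w in F1 F2 * => {A1 D1 B1 A2 D2 B2 rA1 rA2 rB1 rB2 d1 d2 D1p D2p}.
move: es F1 F2; set S := `|s| => es; rewrite /f /sign_of.
case: ifPn => t0.
  rewrite (ger0_norm t0) => F1 F2; have := addr_ge0 F1 (F2 x1 x2).
  congr (0 <= _); rewrite es !rmorphD !rmorphN !rmorphM /= re.
  by field: r2 e2.
rewrite -real_ltNge ?real0 // in t0.
rewrite (ltr0_norm t0) => F1 F2; have := addr_ge0 F1 (F2 x2 x1).
congr (0 <= _); rewrite es !rmorphD !rmorphM /= re.
by field: r2 e2.
Qed.

Lemma overlapZ (b : 'I_4) (w w' : K) (M M' y : bool -> bool -> K) :
  overlap b (fun i j => w * M i j) (fun i j => w' * M' i j) y = w * w' * overlap b M M' y.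
Proof. by rewrite /overlap !big_bool /=; ring. Qed.

Lemma normsq_sqrtC_mul (w w' z : K) : 0 <= w -> 0 <= w' ->
  `|sqrtC w * sqrtC w' * z| ^+ 2 = w * w' * (z * z^*).
Proof. by move=> w0 w'0; rewrite !normrM !exprMn (normCK z) !ger0_norm ?sqrtC_ge0 // !sqrtCK. Qed.

(* Writing [Phi^b = (1 (x) U) Phi^0] with [U] a Pauli operator, [x0 .. x3] are the Bell
   coordinates of [y] after undoing [U], and [ez], [ex] record whether [U] commutes with
   [sigma_z] and [sigma_x]. *)
Lemma bell_coordinates (b : 'I_4) (y : bool -> bool -> K) :
  exists (x0 x1 x2 x3 ez ex : K),
  [/\ ez ^+ 2 = 1 /\ ex ^+ 2 = 1, ez \is Num.real /\ ex \is Num.real,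
   [/\ overlap b idop idop y = x0,
       forall x z, overlap b (xz x z) idop y = z * x1 + x * x2,
       overlap b idop (xz 0 1) y = ez * x1 &
       overlap b idop (xz 1 0) y = ex * x2],
   (forall x z, overlap b (xz x z) (xz 0 1) y = ez * (z * x0 - x * x3)) /\
   (forall x z, overlap b (xz x z) (xz 1 0) y = ex * (z * x3 + x * x0)) &
   (forall c s d t, \sum_i \sum_a \sum_j \sum_a'
       (y i a)^* * Wop (xz s c) (xz c s) (xz ((d - t) / r) ((d + t) / r))
        (xz (- ((d - t) / r)) ((d + t) / r)) b (i, a) (j, a') * y j a' =
      2 * r * (c * d * (x0 * x0^* - x3 * x3^*)
      - s * t * (x0 * x3^* + x3 * x0^*)
      + c * t * (x1 * x1^* - x2 * x2^*) + s * d * (x1 * x2^* + x2 * x1^*))) /\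
   \sum_i \sum_a (y i a)^* * y i a = x0 * x0^* + x1 * x1^* + x2 * x2^* + x3 * x3^*].
Proof.
have r2 := sqrt2_sqr; have rn0 : r != 0 by rewrite sqrtC_eq0 pnatr_eq0.
have rr : (r^-1)^* = r^-1 by apply/CrealP; rewrite realV ger0_real ?sqrt2_ge0.
pose P := r^-1 * (y false false + y true true); pose M := r^-1 * (y false false - y true true).
pose Q := r^-1 * (y false true + y true false); pose N := r^-1 * (y false true - y true false).
pose X (b : 'I_4) : K * K * K * K * K * K := match val b with
  | 0%N => (P, M, Q, N, 1, 1) | 1%N => (M, P, - N, - Q, 1, -1)
  | 2%N => (Q, N, P, M, -1, 1) | _ => (N, Q, - M, - P, -1, -1) end.
exists (X b).1.1.1.1.1, (X b).1.1.1.1.2, (X b).1.1.1.2, (X b).1.1.2, (X b).1.2, (X b).2.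
rewrite /overlap.
by case: b => -[|[|[|[|//]]]] hb; (split; [split | split | split | split | split ]);
  rewrite /X /P /M /Q /N /= ?realN ?real1 ?sqrrN ?expr1n // => *;
  rewrite !big_bool /Wop /chsh /tens /bell_amp /idop /xz /= ?rmorphN ?rmorphM ?rmorphD ?rmorphN
     ?rmorph0 /= ?rr; try field: r2.
Qed.

(** The right-hand side is the quadratic form of the Bell projector pulled back through both
    dephasings, summed over pairs of Kraus operators. *)
Lemma block_inequality c s d t b (y : bool -> bool -> K)
    (p := (d + t) / r) (m := (d - t) / r) :
  angle c s -> angle d t ->
  (4 + 5 * r) / 16 * (\sum_i \sum_a \sum_j \sum_a'
       (y i a)^* * Wop (xz s c) (xz c s) (xz m p) (xz (- m) p) b (i, a) (j, a') * y j a')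
    - (1 + 2 * r) / 4 * (\sum_i \sum_a (y i a)^* * y i a) <=
  \sum_k \sum_l `|overlap b (krausA c s k) (krausC d t l) y| ^+ 2.
Proof.
move=> acs adt.
have /andP[g0 g1] := visibility_bounds acs; have /andP[h0 h1] := visibility_bounds adt.
have r2 := sqrt2_sqr; have rn0 : r != 0 by rewrite sqrtC_eq0 pnatr_eq0.
have rr : (r^-1)^* = r^-1 by apply/CrealP; rewrite realV ger0_real ?sqrt2_ge0.
have ge0 x : 0 <= x -> 0 <= (1 + x) / 2 by move=> x0; rewrite divr_ge0 ?addr_ge0 ?ler01 ?ler0n.
have le1 x : x <= 1 -> 0 <= (1 - x) / 2 by move=> x0; rewrite divr_ge0 ?subr_ge0 ?ler0n.
have -> : \sum_k \sum_l `|overlap b (krausA c s k) (krausC d t l) y| ^+ 2 =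
  \sum_(k : bool) \sum_(l : bool)
    (if k then (1 - visibility c) / 2 else (1 + visibility c) / 2) *
    (if l then (1 - visibility d) / 2 else (1 + visibility d) / 2) *
    (let z := overlap b (if k then xz (sign_of s / r) (1 / r) else idop)
      (if l then if 0 <= t then xz 0 1 else xz 1 0 else idop) y in z * z^*).
  apply: eq_bigr => k _; apply: eq_bigr => l _; rewrite /krausA /krausC.
  by case: k; case: l; rewrite overlapZ normsq_sqrtC_mul //; first [by apply: ge0 | by apply: le1].
have [x0 [x1 [x2 [x3 [ez [ex [[ez2 ex2] [rez rex] [o1 o2 o3 o4] [o5 o6] [-> ->]]]]]]]] :=
  bell_coordinates b y.
apply: le_trans (dephased_bell_ge x0 x1 x2 x3 acs adt) _.
rewrite !big_bool /= o1 o2.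
rewrite le_eqVlt; apply/orP; left; apply/eqP.
have re : (sign_of s)^* = sign_of s by apply/CrealP/sign_of_real.
have cez : ez^* = ez by apply/CrealP.
have cex : ex^* = ex by apply/CrealP.
by case: ifPn => _; rewrite ?o3 ?o4 ?o5 ?o6 !(rmorphM, rmorphD, rmorphN, rmorph1) /=
   ?rr ?cez ?cex ?re; field: r2 ez2 ex2.
Qed.

End Pointwise.

(** * Positive operators *)

Section PositiveOperators.
Local Open Scope sesquilinear_scope.
Variable K : numClosedFieldType.
Implicit Types I J : finType.

Definition hermitian_op I (X : op K I) := forall i j, X i j = (X j i)^*.

Definition mxop I (X : op K I) : 'M[K]_#|I| := \matrix_(i, j) X (enum_val i) (enum_val j).

Lemma sum_enum_val I (F : I -> K) : \sum_i F i = \sum_(k < #|I|) F (enum_val k).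
Proof.
rewrite (reindex (@enum_val I predT)) //=.
exact: (onW_bij _ (enum_val_bij I)).
Qed.

Lemma spectral_op I (H : op K I) : hermitian_op H ->
  exists (E : I -> I -> K) (l : I -> K),
  [/\ forall n, l n \is Num.real,
      forall n m, \sum_x E n x * (E m x)^* = (n == m)%:R,
      forall x y, \sum_n (E n x)^* * E n y = (x == y)%:R &
      forall x y, H x y = \sum_n l n * ((E n x)^* * E n y)].
Proof.
move=> hH; pose M := mxop H.
have hM : M \is hermsymmx.
  by apply/is_hermitianmxP; apply/matrixP => i j; rewrite expr0 scale1r !mxE.
have nM : M \is normalmx by apply: hermitian_normalmx.
have /orthomx_spectralP eM := nM.
set P := spectralmx M in eM; set X := spectral_diag M in eM.
have uP : P \is unitarymx := spectral_unitarymx M.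
have PPt : P *m P ^t* = 1%:M by apply/unitarymxP.
have PtP : P ^t* *m P = 1%:M by rewrite mulmx1C.
have rX i : X 0 i \is Num.real.
  by have /mxOverP/(_ 0 i) := hermitian_spectral_diag_real hM.
have {}eM : M = P ^t* *m diag_mx X *m P by rewrite {1}eM invmx_unitary.
exists (fun n x => P (enum_rank n) (enum_rank x)), (fun n => X 0 (enum_rank n)).
split => [n //|n m|x y|x y].
- rewrite sum_enum_val; move/matrixP/(_ (enum_rank n) (enum_rank m)): PPt.
  rewrite !mxE (inj_eq enum_rank_inj) => <-; apply: eq_bigr => k _.
  by rewrite enum_valK !mxE.
- rewrite sum_enum_val; move/matrixP/(_ (enum_rank x) (enum_rank y)): PtP.
  rewrite !mxE (inj_eq enum_rank_inj) => <-; apply: eq_bigr => k _.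
  by rewrite enum_valK !mxE.
rewrite sum_enum_val; move/matrixP/(_ (enum_rank x) (enum_rank y)): eM.
rewrite !mxE !enum_rankK => ->; apply: eq_bigr => k _; rewrite enum_valK.
by rewrite mul_mx_diag !mxE; ring.
Qed.

Lemma sum_delta I (k : I) (F : I -> K) : \sum_x (x == k)%:R * F x = F k.
Proof.
by rewrite (bigD1 k) //= eqxx mul1r big1 ?addr0 // => x /negbTE ->; exact: mul0r.
Qed.

(** Polarization: the form is real at e_i + a e_j, and a = 1 and a = 'i together give the claim. *)
Lemma psd_hermitian I (X : op K I) : psd X -> hermitian_op X.
Proof.
move=> pX i j.
have q a : 0 <= X i i + a * X i j + a^* * X j i + a^* * a * X j j.
  have := pX (fun x => (x == i)%:R + (x == j)%:R * a).
  congr (0 <= _).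
  under eq_bigr => x _ do under eq_bigr => y _ do
    rewrite rmorphD rmorphM /= !conjC_nat [_ * _ * (_ + _)]mulrC mulrDl -mulrA.
  under eq_bigr => x _ do
    rewrite big_split /= !sum_delta.
  rewrite (eq_bigr (fun x => (x == i)%:R * (X x i + a * X x j) +
                             (x == j)%:R * (a^* * (X x i + a * X x j)))); last first.
    by move=> x _; ring.
  by rewrite big_split /= !sum_delta; ring.
have dii k : X k k \is Num.real.
  have := pX (fun x => (x == k)%:R).
  under eq_bigr => x _ do under eq_bigr => y _ do rewrite conjC_nat [_ * _ * _]mulrC.
  under eq_bigr => x _ do rewrite sum_delta.
  by rewrite sum_delta; apply: ger0_real.
have imag a : a * X i j + a^* * X j i \is Num.real.
  have -> : a * X i j + a^* * X j i = (X i i + a * X i j + a^* * X j i + a^* * a * X j j)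
      - X i i - a * a^* * X j j by ring.
  apply: realB; first by apply: realB; [apply/ger0_real/q | apply: dii].
  by apply: realM; [apply/ger0_real/mul_conjC_ge0 | apply: dii].
have h1 := CrealP (imag 1); have h2 := CrealP (imag 'i).
rewrite !rmorphD !rmorphM /= !conjCK !rmorph1 !mul1r in h1.
rewrite !rmorphD !rmorphM /= !conjCK !conjCi in h2.
have i0 : 'i != 0 :> K by apply: neq0Ci.
have {}h2 : - (X i j)^* + (X j i)^* = X i j - X j i.
  by apply: (mulfI i0); rewrite !mulrDr !mulrN -!mulNr h2.
have : 2 * X i j = 2 * (X j i)^*.
  rewrite !mulr2n !mulrDl !mul1r; apply/eqP; rewrite -subr_eq0; apply/eqP.
  have -> : X i j + X i j - ((X j i)^* + (X j i)^*) =
    (X i j - X j i) - (- (X i j)^* + (X j i)^*) + ((X i j + X j i) - ((X i j)^* + (X j i)^*)) by ring.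
  by rewrite h2 -h1; ring.
by apply: mulfI; rewrite pnatr_eq0.
Qed.

(** Gram vectors are the working form of positivity: most later positivity claims become
    rearrangements of finite sums. *)
Lemma psd_gram I (X : op K I) : psd X ->
  exists g : I -> I -> K, forall x y, X x y = \sum_n (g n x)^* * g n y.
Proof.
move=> pX; have [E [l [rl EEt EtE XE]]] := spectral_op (psd_hermitian pX).
have l0 n : 0 <= l n.
  have := pX (fun x => (E n x)^*).
  congr (0 <= _).
  transitivity (\sum_m l m * ((\sum_x E n x * (E m x)^*) * (\sum_y E m y * (E n y)^*))).
    under [RHS]eq_bigr => m _ do rewrite big_distrlr /= mulr_sumr.
    rewrite [RHS]exchange_big /=; apply: eq_bigr => x _.
    under [RHS]eq_bigr => m _ do rewrite mulr_sumr.
    rewrite [RHS]exchange_big /=; apply: eq_bigr => y _.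
    rewrite XE conjCK mulr_sumr mulr_suml; apply: eq_bigr => m _; ring.
  under eq_bigr => m _ do rewrite !EEt.
  rewrite (bigD1 n) //= eqxx !mulr1 big1 ?addr0 // => m /negbTE nm.
  by rewrite nm eq_sym nm !mul0r mulr0.
exists (fun n x => sqrtC (l n) * E n x) => x y; rewrite XE; apply: eq_bigr => n _.
have /ger0_real/CrealP rs : 0 <= sqrtC (l n) by rewrite sqrtC_ge0.
by rewrite rmorphM /= rs mulrACA -expr2 sqrtCK.
Qed.

Definition qform I (X : op K I) (v : I -> K) : K :=
  \sum_x \sum_y (v x)^* * X x y * v y.

Lemma qform_gram I J (g : J -> I -> K) (X : op K I) (v : I -> K) :
  (forall x y, X x y = \sum_n (g n x)^* * g n y) ->
  qform X v = \sum_n `|\sum_i g n i * v i| ^+ 2.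
Proof.
move=> XE; under [RHS]eq_bigr => n _ do rewrite normCK rmorph_sum mulrC big_distrlr /=.
rewrite [RHS]exchange_big /=; apply: eq_bigr => x _.
rewrite [RHS]exchange_big /=; apply: eq_bigr => y _.
by rewrite XE mulr_sumr mulr_suml; apply: eq_bigr => n _; rewrite rmorphM /=; ring.
Qed.

Lemma gram_psd I J (g : J -> I -> K) (X : op K I) :
  (forall x y, X x y = \sum_n (g n x)^* * g n y) -> psd X.
Proof.
by move=> XE v; rewrite -/(qform X v) (qform_gram v XE) sumr_ge0 // => n _; exact: exprn_ge0.
Qed.

End PositiveOperators.

(** * Jordan's lemma *)

Section Jordan.
Local Open Scope sesquilinear_scope.
Variable K : numClosedFieldType.
Local Notation r := (sqrtC (2 : K)).

Lemma trmxC_mul m n p (A : 'M[K]_(m, n)) (B : 'M[K]_(n, p)) :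
  (A *m B) ^t* = B ^t* *m A ^t*.
Proof. by rewrite trmx_mul map_mxM. Qed.

Lemma mul_trmxC_diag m n (A : 'M[K]_(m, n)) i :
  (A *m A ^t*) i i = \sum_k `|A i k| ^+ 2.
Proof. by rewrite mxE; apply: eq_bigr => k _; rewrite normCK !mxE. Qed.

Definition sine (x : K) : K := sqrtC (1 - x ^+ 2).

Lemma sine_ge0 x : -1 <= x <= 1 -> 0 <= sine x.
Proof.
move=> /andP[x0 x1]; rewrite sqrtC_ge0.
have -> : 1 - x ^+ 2 = (1 - x) * (x - (-1)) by ring.
by rewrite mulr_ge0 // subr_ge0.
Qed.

Section DiagonalAnticommutator.
Variables (n : nat) (a b : 'M[K]_n) (d : 'rV[K]_n).
Hypotheses (aH : a ^t* = a) (bH : b ^t* = b) (a2 : a *m a = 1%:M) (b2 : b *m b = 1%:M).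
Hypothesis abd : a *m b + b *m a = 2 *: diag_mx d.
Hypothesis d_real : forall i, d 0 i \is Num.real.

Let F (f : K -> K) : 'M[K]_n := diag_mx (map_mx f d).
Let D := F id.

Let FE (f : K -> K) i j : F f i j = f (d 0 i) *+ (i == j).
Proof. by rewrite !mxE. Qed.

Let DE : D = diag_mx d.
Proof. by apply/matrixP => i j; rewrite FE !mxE. Qed.

Let FM f g : F f *m F g = F (fun x => f x * g x).
Proof.
by apply/matrixP => i j; rewrite mul_diag_mx !mxE mulrnAr.
Qed.

Let FC f g : F f *m F g = F g *m F f.
Proof. by rewrite !FM; apply/matrixP => i j; rewrite !FE mulrC. Qed.

Let aD : a *m D = D *m a.
Proof.
apply: (scalerI (_ : 2 != 0)); first by rewrite pnatr_eq0.
rewrite [LHS]scalemxAr [RHS]scalemxAl DE -abd mulmxDr mulmxDl !mulmxA a2 mul1mx.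
by rewrite -[b *m a *m a]mulmxA a2 mulmx1 addrC.
Qed.

Let bD : b *m D = D *m b.
Proof.
apply: (scalerI (_ : 2 != 0)); first by rewrite pnatr_eq0.
rewrite [LHS]scalemxAr [RHS]scalemxAl DE -abd mulmxDr mulmxDl !mulmxA b2 mul1mx.
by rewrite -[a *m b *m b]mulmxA b2 mulmx1 addrC.
Qed.

(** A nonzero entry [M i j] forces d_i = d_j, hence commutation with every function of [D]. *)
Let commF (M : 'M[K]_n) f : M *m D = D *m M -> M *m F f = F f *m M.
Proof.
move=> MD; apply/matrixP => i j; rewrite mul_mx_diag mul_diag_mx !mxE.
move/matrixP/(_ i j): MD; rewrite mul_mx_diag mul_diag_mx !mxE => e.
have [-> | nz] := eqVneq (M i j) 0; first by rewrite mul0r mulr0.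
by rewrite (mulfI nz (etrans e (mulrC _ _))) mulrC.
Qed.

Let FH f : (forall i, f (d 0 i) \is Num.real) -> (F f) ^t* = F f.
Proof.
move=> fr; apply/matrixP => i j; rewrite !mxE eq_sym.
by case: eqP => [->|]; rewrite ?mulr0n ?rmorph0 // mulr1n (CrealP (fr _)).
Qed.

(** The diagonal entries of (a + e b)^2 for e = 1 and e = -1 are 2 + 2 e d_i, and they are
    nonnegative because a + e b is hermitian. *)
Let anticomm_range i : -1 <= d 0 i <= 1.
Proof.
have h (e : K) : e ^+ 2 = 1 -> e \is Num.real -> 0 <= 2 + 2 * (e * d 0 i).
  move=> e2 er; have := mul_trmxC_diag (a + e *: b) i.
  have -> : (a + e *: b) *m (a + e *: b) ^t* = 2%:M + 2 *: (e *: D).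
    rewrite linearD linearZ /= map_mxD map_mxZ aH bH /= (CrealP er).
    rewrite mulmxDr !mulmxDl -!scalemxAl -!scalemxAr !scalerA -expr2 e2 a2 b2 scale1r.
    have := abd; rewrite DE; move: (a *m b) (b *m a) (diag_mx d) => X Y Z e3.
    apply/matrixP => k l; move/matrixP/(_ k l): e3; rewrite !mxE => /(canRL (addrK _)) e3.
    by case: (k == l); rewrite ?mulr1n ?mulr0n; ring: e3.
  rewrite !mxE eqxx !mulr1n => ->; apply: sumr_ge0 => k _; exact: exprn_ge0.
have h1 := h 1 (expr1n _ _) (real1 _).
have h2 : 0 <= 2 + 2 * (-1 * d 0 i) by apply: h; rewrite ?sqrrN ?expr1n ?realN ?real1.
have p2 : 0 < 2 :> K by rewrite ltr0n.
apply/andP; split.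
  rewrite -subr_ge0 opprK -(pmulr_rge0 _ p2) mulrDr mulr1 addrC.
  by rewrite mul1r in h1.
by rewrite -subr_ge0 -(pmulr_rge0 _ p2) mulrBr mulr1 -mulrN -mulN1r.
Qed.

Let S := F sine.
(** [B] is the part of [b] that anticommutes with [a], and B^2 = 1 - D^2. Since 0^-1 = 0, [T] is the
    partial symmetry in B = S T, zero on the kernel of [S], where [b] is [a] up to sign. *)
Let B := b - D *m a.
Let T := F (fun x => (sine x)^-1) *m B.
(** Makes [Q] the square root of (1 + T) / 2: where [S] is invertible that operator is a projector,
    and where T = 0 the root is 1 / sqrt 2. *)
Let q (x : K) : K := if sine x == 0 then r^-1 else 2^-1.
Let Q := F q + 2^-1 *: T.

Let BD : B *m D = D *m B.
Proof. by rewrite mulmxBl mulmxBr bD -mulmxA aD. Qed.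

Let BH : B ^t* = B.
Proof. by rewrite linearB /= map_mxB trmxC_mul aH bH FH // aD. Qed.

Let Ba : B *m a + a *m B = 0.
Proof.
rewrite mulmxBl mulmxBr addrACA [b *m a + _]addrC abd !mulmxA aD.
rewrite -[D *m a *m a]mulmxA a2 mulmx1 -DE.
by rewrite scaler_nat mulr2n -opprD subrr.
Qed.

Let B2 : B *m B = F (fun x => 1 - x ^+ 2).
Proof.
have -> : B *m B = 1%:M - D *m (a *m b + b *m a) + D *m D.
  rewrite /B mulmxBl !mulmxBr b2 mulmxA bD -!mulmxA [a *m (D *m a)]mulmxA aD.
  rewrite -[D *m a *m a]mulmxA a2 mulmx1 mulmxDr.
  by rewrite opprB opprD !addrA [LHS]addrAC; congr (_ + _); rewrite addrAC.
rewrite abd -DE -scalemxAr FM; apply/matrixP => i j; rewrite !mxE.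
by case: (i == j); rewrite ?mulr1n ?mulr0n; ring.
Qed.

Let sine2 x : sine x ^+ 2 = 1 - x ^+ 2.
Proof. exact: sqrtCK. Qed.

Let FT f : F f *m T = T *m F f.
Proof.
have TD : T *m D = D *m T by rewrite /T -mulmxA BD !mulmxA FC.
by rewrite -commF.
Qed.

(** A vanishing sine kills row i of [B], whose squared norm is the diagonal entry 1 - d_i^2 of
    B^2. *)
Let ST : S *m T = B.
Proof.
rewrite /T mulmxA FM; apply/matrixP => i j; rewrite mul_diag_mx mxE [map_mx _ _ _ _]mxE.
have [s0 | s0] := eqVneq (sine (d 0 i)) 0; last by rewrite divff // mul1r.
rewrite s0 !mul0r; symmetry.
have : \sum_k `|B i k| ^+ 2 = 0.
  by rewrite -mul_trmxC_diag BH B2 FE eqxx -sine2 s0 expr0n.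
move/eqP; rewrite psumr_eq0 => [|k _]; last exact: exprn_ge0.
move/allP/(_ j (mem_index_enum _)); rewrite expf_eq0 normr_eq0 /= => /eqP.
exact.
Qed.

Let Ta : T *m a = - (a *m T).
Proof.
apply/eqP; rewrite -addr_eq0; apply/eqP.
rewrite /T mulmxA commF //; rewrite -!mulmxA -mulmxDr Ba mulmx0 //.
Qed.

Let T2 : T *m T = F (fun x => (sine x)^-1 * sine x).
Proof.
rewrite {2}/T mulmxA -FT -mulmxA /T -!mulmxA B2 !mulmxA !FM.
apply/matrixP => i j; rewrite !FE -sine2; congr (_ *+ _).
have [-> | s0] := eqVneq (sine (d 0 i)) 0; first by rewrite expr0n invr0 !mulr0.
by field.
Qed.

Let TH : T ^t* = T.
Proof.
rewrite /T trmxC_mul BH (FH (f := fun x => (sine x)^-1)).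
  exact: commF.
by move=> i; rewrite realV ger0_real ?sine_ge0 ?anticomm_range.
Qed.

Let QH : Q ^t* = Q.
Proof.
rewrite linearD linearZ /= map_mxD map_mxZ TH FH /=; last first.
  by move=> i; rewrite /q; case: ifP => _; rewrite realV ?realn ?ger0_real ?sqrtC_ge0 ?ler0n.
by rewrite fmorphV /= conjC_nat.
Qed.

Let Q2 : Q *m Q = 2^-1 *: (1%:M + T).
Proof.
have qT : F q *m T = 2^-1 *: T.
  rewrite /T mulmxA FM scalemxAl; congr (_ *m B); apply/matrixP => i j.
  rewrite !mxE mulrnAr /q; have [-> | //] := eqVneq (sine _) 0.
  by rewrite invr0 !mulr0.
rewrite /Q mulmxDl !mulmxDr -!scalemxAr -!scalemxAl -FT qT FM T2.
rewrite scalerDr; apply/matrixP => i j; rewrite !mxE /q.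
have r2 : r^-1 * r^-1 = 2^-1 by rewrite -invfM -expr2 sqrtCK.
have [-> | s0] := eqVneq (sine _) 0.
  by rewrite r2 mulr0 mul0rn; case: (i == j); rewrite ?mulr1n ?mulr0n; field.
by rewrite mulVf //; case: (i == j); rewrite ?mulr1n ?mulr0n; field.
Qed.

(** The qubit arises by dilation, not by pairing eigenvectors: x goes to (Q x, Q a x), where [a]
    becomes the swap of the components. The identities follow from Q^2 = (1 + T) / 2, T a = - a T
    and b = D a + S T. Common eigenvectors of [a] and [b] are covered too: Q = 1 / sqrt 2 there, and
    they go to eigenvectors of the swap. *)
Lemma jordan_diag : exists2 V : bool -> 'M[K]_n, (forall i, -1 <= d 0 i <= 1) &
  [/\ (V false) ^t* *m V false + (V true) ^t* *m V true = 1%:M,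
      a = (V false) ^t* *m V true + (V true) ^t* *m V false &
      b = (V false) ^t* *m D *m V true + (V true) ^t* *m D *m V false
        + ((V false) ^t* *m S *m V false - (V true) ^t* *m S *m V true)].
Proof.
exists (fun j => if j then Q *m a else Q) => //=; rewrite trmxC_mul aH QH.
have QF f : Q *m F f = F f *m Q.
  by rewrite mulmxDl mulmxDr -scalemxAl -scalemxAr FT FC.
have aQa : a *m Q *m (Q *m a) = 2^-1 *: (1%:M - T).
  rewrite mulmxA -[a *m Q *m Q]mulmxA Q2 -scalemxAr -scalemxAl mulmxDr mulmx1 mulmxDl a2.
  by rewrite -[a *m T *m a]mulmxA Ta mulmxN mulmxA a2 mul1mx.
have QQa : Q *m (Q *m a) + a *m Q *m Q = a.
  rewrite mulmxA -[a *m Q *m Q]mulmxA Q2 -scalemxAl -scalemxAr mulmxDl mulmxDr mul1mx mulmx1.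
  rewrite -scalerDr Ta addrACA addNr addr0 -mulr2n -scaler_nat scalerA mulVf ?scale1r //.
  by rewrite pnatr_eq0.
split.
- rewrite aQa Q2 -scalerDr addrACA subrr addr0 -mulr2n -scaler_nat scalerA mulVf ?scale1r //.
  by rewrite pnatr_eq0.
- by rewrite QQa.
rewrite QF -[a *m Q *m D]mulmxA QF !mulmxA aD -!mulmxA -mulmxDr [a *m (Q *m Q)]mulmxA QQa.
rewrite [Q *m (S *m Q)]mulmxA QF [Q *m (S *m (Q *m a))]mulmxA QF -!mulmxA.
rewrite [a *m (S *m _)]mulmxA commF // -mulmxA [a *m (Q *m _)]mulmxA aQa Q2 -mulmxBr -scalerBr.
rewrite opprB [1%:M + T + _]addrC addrA subrK -mulr2n -scaler_nat scalerA mulVf ?scale1r.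
  by rewrite ST /B addrC subrK.
by rewrite pnatr_eq0.
Qed.

End DiagonalAnticommutator.

(** The block diagonal operator of the [M n], pulled back along a map V from K^I to a direct sum of
    qubits indexed by [N]. Such families are later read as Kraus operators of a channel from K^I to
    one qubit; [isometric] is then trace preservation. *)
Definition sandwich (N I : finType) (V : N -> bool -> I -> K) (M : N -> bool -> bool -> K)
    : op K I :=
  fun x y => \sum_n \sum_i \sum_j (V n i x)^* * M n i j * V n j y.

Definition isometric (N I : finType) (V : N -> bool -> I -> K) : Prop :=
  forall x y, sandwich V (fun=> idop) x y = idop x y.

Lemma mxop_mul (I : finType) (X Y : op K I) : mxop (mulop X Y) = mxop X *m mxop Y.
Proof.
apply/matrixP => i j; rewrite !mxE /mulop sum_enum_val; apply: eq_bigr => k _.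
by rewrite !mxE.
Qed.

Lemma mxop_id (I : finType) : mxop (@idop K I) = 1%:M.
Proof. by apply/matrixP => i j; rewrite !mxE /idop (inj_eq enum_val_inj). Qed.

Lemma mxopE (I : finType) (X : op K I) x y : X x y = mxop X (enum_rank x) (enum_rank y).
Proof. by rewrite mxE !enum_rankK. Qed.

Lemma observable_mx (I : finType) (X : op K I) : observable X ->
  (mxop X) ^t* = mxop X /\ mxop X *m mxop X = 1%:M.
Proof.
case=> hX X2; rewrite -mxop_mul X2 mxop_id; split=> //.
by apply/matrixP => i j; rewrite !mxE -hX.
Qed.

Lemma jordan_op (I : finType) (A0 A1 : op K I) : observable A0 -> observable A1 ->
  exists (V : 'I_#|I| -> bool -> I -> K) (d : 'I_#|I| -> K),
  [/\ forall n, -1 <= d n <= 1, isometric V,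
      forall x y, A0 x y = sandwich V (fun=> xz 1 0) x y &
      forall x y, A1 x y = sandwich V (fun n => xz (d n) (sine (d n))) x y].
Proof.
move=> /observable_mx[]; set a := mxop A0 => aH a2.
move=> /observable_mx[]; set b := mxop A1 => bH b2.
pose M := 2^-1 *: (a *m b + b *m a).
have hM : M \is hermsymmx.
  apply/is_hermitianmxP; rewrite expr0 scale1r /M linearZ /= map_mxZ [(_ + _)^T]linearD /= map_mxD.
  by rewrite !trmxC_mul aH bH /= fmorphV /= conjC_nat addrC.
have /orthomx_spectralP eM : M \is normalmx by apply: hermitian_normalmx.
set P := spectralmx M in eM; set X := spectral_diag M in eM.
have uP : P \is unitarymx := spectral_unitarymx M.
have PPt : P *m P ^t* = 1%:M by apply/unitarymxP.
have PtP : P ^t* *m P = 1%:M by rewrite mulmx1C.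
have rX i : X 0 i \is Num.real.
  by have /mxOverP/(_ 0 i) := hermitian_spectral_diag_real hM.
have {}eM : P *m M *m P ^t* = diag_mx X.
  by rewrite {1}eM invmx_unitary // !mulmxA PPt mul1mx -mulmxA PPt mulmx1.
pose cj (Y : 'M[K]_#|I|) := P *m Y *m P ^t*.
have cjM Y Z : cj Y *m cj Z = cj (Y *m Z).
  by rewrite /cj !mulmxA -[_ *m P ^t* *m P]mulmxA PtP mulmx1.
have cjH Y : Y ^t* = Y -> (cj Y) ^t* = cj Y.
  by move=> YH; rewrite /cj !trmxC_mul trmxCK YH mulmxA.
have cj1 : cj 1%:M = 1%:M by rewrite /cj mulmx1.
have cjK Y : P ^t* *m cj Y *m P = Y.
  by rewrite /cj !mulmxA PtP mul1mx -mulmxA PtP mulmx1.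
have [|||V Xr [V1 Va Vb]] := @jordan_diag _ (cj a) (cj b) X (cjH _ aH) (cjH _ bH) _ _ _ rX.
- by rewrite cjM a2.
- by rewrite cjM b2.
- rewrite !cjM -eM /cj /M -mulmxDl -mulmxDr -scalemxAr -scalemxAl scalerA mulfV ?scale1r //.
  by rewrite pnatr_eq0.
pose W i : 'M[K]_#|I| := V i *m P.
have WW i (Y : 'M[K]_#|I|) j : (W i) ^t* *m Y *m W j = P ^t* *m ((V i) ^t* *m Y *m V j) *m P.
  by rewrite /W trmxC_mul !mulmxA.
have WE i j (e : 'rV[K]_#|I|) x y : ((W i) ^t* *m diag_mx e *m W j) x y =
    \sum_n (W i n x)^* * e 0 n * W j n y.
  by rewrite mxE; apply: eq_bigr => n _; rewrite mul_mx_diag !mxE.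
have WE1 i j x y : ((W i) ^t* *m W j) x y = \sum_n (W i n x)^* * W j n y.
  by rewrite mxE; apply: eq_bigr => n _; rewrite !mxE.
have addE (Y Z : 'M[K]_#|I|) x y : (Y + Z) x y = Y x y + Z x y by rewrite mxE.
have oppE (Y : 'M[K]_#|I|) x y : (- Y) x y = - Y x y by rewrite mxE.
exists (fun n i x => W i n (enum_rank x)), (fun n => X 0 n); split=> //.
- move=> x y; have : P ^t* *m (V false ^t* *m V false + V true ^t* *m V true) *m P = 1%:M.
    by rewrite V1 -{1}cj1 cjK.
  rewrite mulmxDr mulmxDl.
  have := WW false 1%:M false; have := WW true 1%:M true; rewrite !mulmx1 => <- <-.
  move/matrixP/(_ (enum_rank x) (enum_rank y)); rewrite mxE !WE1 -big_split /= mxE.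
  rewrite (inj_eq enum_rank_inj) /idop => <-; apply: eq_bigr => n _.
  by rewrite !big_bool /idop /=; ring.
- move=> x y; rewrite mxopE -/a -(cjK a) Va mulmxDr mulmxDl.
  have := WW false 1%:M true; have := WW true 1%:M false; rewrite !mulmx1 => <- <-.
  rewrite mxE !WE1 -big_split /=; apply: eq_bigr => n _.
  by rewrite !big_bool /xz /=; ring.
move=> x y; rewrite mxopE -/b -(cjK b) Vb mulmxDr mulmxDl !mulmxDr !mulmxDl.
rewrite !mulmxN !mulNmx -!WW !addE oppE !WE -sumrN -!big_split /=; apply: eq_bigr => n _.
by rewrite !big_bool /xz /= !mxE; ring.
Qed.

Lemma sandwich_rotate (N I : finType) (V : N -> bool -> I -> K) (R M M' : N -> bool -> bool -> K) :
  (forall n k l, \sum_i \sum_j (R n i k)^* * M' n i j * R n j l = M n k l) ->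
  forall x y, sandwich (fun n i x => \sum_j R n i j * V n j x) M' x y = sandwich V M x y.
Proof.
move=> RM x y; apply: eq_bigr => n _.
under [RHS]eq_bigr => i _ do under eq_bigr => j _ do rewrite -RM.
by rewrite !big_bool /= !rmorphD !rmorphM /=; ring.
Qed.

(** With [sin_half], the cosine and sine of half the arcsine of [x]. *)
Definition cos_half (x : K) : K := (sqrtC (1 + x) + sqrtC (1 - x)) / 2.
Definition sin_half (x : K) : K := (sqrtC (1 + x) - sqrtC (1 - x)) / 2.

Lemma sqrt_range (x : K) : -1 <= x <= 1 -> 0 <= sqrtC (1 + x) /\ 0 <= sqrtC (1 - x).
Proof.
move=> /andP[h1 h2]; rewrite !sqrtC_ge0 subr_ge0; split=> //.
by rewrite addrC -[1]opprK subr_ge0.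
Qed.

Lemma sineE (x : K) : -1 <= x <= 1 -> sine x = sqrtC (1 + x) * sqrtC (1 - x).
Proof.
move=> /sqrt_range[]; rewrite !sqrtC_ge0 => h1 h2.
by rewrite -sqrtCM ?nnegrE //; congr sqrtC; ring.
Qed.

Lemma angle_half (x : K) : -1 <= x <= 1 -> angle (cos_half x) (sin_half x).
Proof.
move=> /sqrt_range[]; rewrite /cos_half /sin_half.
have := sqrtCK (1 + x); have := sqrtCK (1 - x).
move: (sqrtC (1 + x)) (sqrtC (1 - x)) => P M M2 P2 P0 M0.
have rP := ger0_real P0; have rM := ger0_real M0.
have r2 : 2^-1 \is @Num.real K by rewrite realV realn.
have rs : (P - M) / 2 \is Num.real by apply: realM => //; apply: realB.
split=> //; first by apply: realM => //; apply: realD.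
  apply/(real_ler_normlP rs); split; rewrite -?mulNr ler_wpM2r ?invr_ge0 ?ler0n // ?opprB.
    by rewrite addrC lerD2r (le_trans _ P0) // oppr_le0.
  by rewrite lerD2l (le_trans _ M0) // oppr_le0.
by field: M2 P2.
Qed.

(** Conjugating a qubit turns directions in the sigma_x, sigma_z plane by twice the angle, so
    aligning a frame with (m, p) takes the half-angle square roots. *)
Lemma half_angle (m p : K) : m \is Num.real -> 0 <= p -> m ^+ 2 + p ^+ 2 = 1 ->
  exists u v : K, [/\ u \is Num.real, v \is Num.real, u ^+ 2 - v ^+ 2 = m,
    2 * u * v = p & u ^+ 2 + v ^+ 2 = 1].
Proof.
move=> rm p0 mp.
have : `|m| <= 1.
  rewrite -(ler_pXn2r (n := 2)) ?nnegrE ?ler01 // expr1n real_normK // -mp lerDl.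
  exact: exprn_ge0.
rewrite real_ler_norml // => m1.
have [] := sqrt_range m1; rewrite !sqrtC_ge0 => mp0 mm0.
have h0 : 0 <= 2^-1 :> K by rewrite invr_ge0 ler0n.
exists (sqrtC ((1 + m) / 2)), (sqrtC ((1 - m) / 2)); rewrite !sqrtCK.
split; [| | by field | | by field].
- by rewrite ger0_real // sqrtC_ge0 mulr_ge0.
- by rewrite ger0_real // sqrtC_ge0 mulr_ge0.
rewrite -mulrA -sqrtCM ?nnegrE ?mulr_ge0 //.
have -> : (1 + m) / 2 * ((1 - m) / 2) = (p / 2) ^+ 2.
  have pE : p ^+ 2 = 1 - m ^+ 2 by rewrite -mp addrC addKr.
  by field: pE.
by rewrite sqrCK ?mulr_ge0 //; field.
Qed.

(* The block frames of the two parties are rotated against each other by [pi/4], so that at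
   [c = 1], [s = 0] the maximal eigenvector of [W_b] is the standard Bell state [Phi^b]. *)
Lemma frameA (I : finType) (A0 A1 : op K I) : observable A0 -> observable A1 ->
  exists (V : 'I_#|I| -> bool -> I -> K) (c s : 'I_#|I| -> K),
  [/\ forall n, angle (c n) (s n), isometric V,
      forall x y, A0 x y = sandwich V (fun n => xz (s n) (c n)) x y &
      forall x y, A1 x y = sandwich V (fun n => xz (c n) (s n)) x y].
Proof.
move=> hA0 hA1; have [V [d [d1 V1 VA0 VA1]]] := jordan_op hA0 hA1.
have ang n := angle_half (d1 n).
have [u hu] : exists u : 'I_#|I| -> K * K, forall n, [/\ (u n).1 \is Num.real,
    (u n).2 \is Num.real, (u n).1 ^+ 2 - (u n).2 ^+ 2 = sin_half (d n),
    2 * (u n).1 * (u n).2 = cos_half (d n) & (u n).1 ^+ 2 + (u n).2 ^+ 2 = 1].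
  apply: (@fin_all_exists _ _ (fun n (p : K * K) => [/\ p.1 \is Num.real, p.2 \is Num.real,
    p.1 ^+ 2 - p.2 ^+ 2 = sin_half (d n),
    2 * p.1 * p.2 = cos_half (d n) & p.1 ^+ 2 + p.2 ^+ 2 = 1])) => n.
  have [_ rs sc cs] := ang n; rewrite addrC in cs.
  have [u [v h]] := half_angle rs (le_trans (normr_ge0 _) sc) cs.
  by exists (u, v).
(* A reflection: in the sigma_x, sigma_z plane the pair (s, c), (c, s) is oriented oppositely to the
   Jordan pair (1, 0), (d, sine d). *)
pose R n : bool -> bool -> K := xz (u n).1 (u n).2.
exists (fun n i x => \sum_j R n i j * V n j x), (fun n => cos_half (d n)),
  (fun n => sin_half (d n)).
split=> // x y.
- rewrite -V1; apply: sandwich_rotate => n k l.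
  have [/CrealP ru /CrealP rv _ _ uv] := hu n.
  have {}uv : (u n).1 ^+ 2 = 1 - (u n).2 ^+ 2 by rewrite -uv addrK.
  by case: k; case: l; rewrite !big_bool /R /xz /idop /= ?rmorphN /= ?ru ?rv; ring: uv.
- rewrite VA0; symmetry; apply: sandwich_rotate => n k l.
  have [/CrealP ru /CrealP rv <- <- uv] := hu n.
  have {}uv : (u n).1 ^+ 2 = 1 - (u n).2 ^+ 2 by rewrite -uv addrK.
  by case: k; case: l; rewrite !big_bool /R /xz /idop /= ?rmorphN /= ?ru ?rv; ring: uv.
rewrite VA1; symmetry; apply: sandwich_rotate => n k l.
have [/CrealP ru /CrealP rv es ec uv] := hu n.
have ed : d n = 2 * cos_half (d n) * sin_half (d n).
  rewrite /cos_half /sin_half; have := sqrtCK (1 + d n); have := sqrtCK (1 - d n).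
  move: (sqrtC (1 + d n)) (sqrtC (1 - d n)) => P M M2 P2; by field: M2 P2.
have esi : sine (d n) = cos_half (d n) ^+ 2 - sin_half (d n) ^+ 2.
  by rewrite sineE // /cos_half /sin_half; field.
have -> : xz (d n) (sine (d n)) k l = xz (2 * cos_half (d n) * sin_half (d n))
    (cos_half (d n) ^+ 2 - sin_half (d n) ^+ 2) k l by rewrite -ed -esi.
rewrite -es -ec.
have {}uv : (u n).1 ^+ 2 = 1 - (u n).2 ^+ 2 by rewrite -uv addrK.
by case: k; case: l; rewrite !big_bool /R /xz /idop /= ?rmorphN /= ?ru ?rv; ring: uv.
Qed.

Lemma frameC (I : finType) (C0 C1 : op K I) : observable C0 -> observable C1 ->
  exists (V : 'I_#|I| -> bool -> I -> K) (c s : 'I_#|I| -> K),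
  [/\ forall n, angle (c n) (s n), isometric V,
      forall x y, C0 x y = sandwich V (fun n => xz ((c n - s n) / r) ((c n + s n) / r)) x y &
      forall x y, C1 x y = sandwich V (fun n => xz (- ((c n - s n) / r)) ((c n + s n) / r)) x y].
Proof.
move=> hC0 hC1; have [V [d [d1 V1 VC0 VC1]]] := jordan_op hC0 hC1.
have r2 : r ^+ 2 = 2 := sqrt2_sqr K; have rn0 : r != 0 by rewrite sqrtC_eq0 pnatr_eq0.
pose p n := sqrtC (1 + d n) / r; pose m n := sqrtC (1 - d n) / r.
have pE n : (cos_half (d n) + sin_half (d n)) / r = p n.
  by rewrite /cos_half /sin_half /p; field.
have mE n : (cos_half (d n) - sin_half (d n)) / r = m n.
  by rewrite /cos_half /sin_half /m; field.
have pm n : [/\ m n \is Num.real, 0 <= p n & m n ^+ 2 + p n ^+ 2 = 1].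
  have [p0 m0] := sqrt_range (d1 n); split.
  - by rewrite ger0_real // divr_ge0 // sqrt2_ge0.
  - by rewrite divr_ge0 // sqrt2_ge0.
  by rewrite /m /p !exprMn !sqrtCK exprVn r2; field.
have [u hu] : exists u : 'I_#|I| -> K * K, forall n, [/\ (u n).1 \is Num.real,
    (u n).2 \is Num.real, (u n).1 ^+ 2 - (u n).2 ^+ 2 = m n,
    2 * (u n).1 * (u n).2 = p n & (u n).1 ^+ 2 + (u n).2 ^+ 2 = 1].
  apply: (@fin_all_exists _ _ (fun n (w : K * K) => [/\ w.1 \is Num.real, w.2 \is Num.real,
    w.1 ^+ 2 - w.2 ^+ 2 = m n, 2 * w.1 * w.2 = p n & w.1 ^+ 2 + w.2 ^+ 2 = 1])) => n.
  have [rm p0 mp] := pm n; have [u [v h]] := half_angle rm p0 mp.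
  by exists (u, v).
(* The column flip is multiplication by sigma_x and makes a rotation out of the reflection, because
   this pair is oriented like the Jordan pair. *)
pose R n (i j : bool) : K := xz (u n).1 (u n).2 i (~~ j).
exists (fun n i x => \sum_j R n i j * V n j x), (fun n => cos_half (d n)),
  (fun n => sin_half (d n)).
split=> [n | x y | x y | x y]; first exact: angle_half.
- rewrite -V1; apply: sandwich_rotate => n k l.
  have [/CrealP ru /CrealP rv _ _ uv] := hu n.
  have {}uv : (u n).1 ^+ 2 = 1 - (u n).2 ^+ 2 by rewrite -uv addrK.
  by case: k; case: l; rewrite !big_bool /R /xz /idop /= ?rmorphN /= ?ru ?rv; ring: uv.
- rewrite VC0; symmetry; apply: sandwich_rotate => n k l.
  have [/CrealP ru /CrealP rv es ec uv] := hu n; rewrite pE mE -es -ec.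
  have {}uv : (u n).1 ^+ 2 = 1 - (u n).2 ^+ 2 by rewrite -uv addrK.
  by case: k; case: l; rewrite !big_bool /R /xz /idop /= ?rmorphN /= ?ru ?rv; ring: uv.
rewrite VC1; symmetry; apply: sandwich_rotate => n k l.
have [/CrealP ru /CrealP rv es ec uv] := hu n.
have ed : d n = p n ^+ 2 - m n ^+ 2.
  by rewrite /m /p !exprMn !sqrtCK exprVn r2; field.
have esi : sine (d n) = 2 * m n * p n.
  by rewrite sineE // /m /p; field: r2.
have -> : xz (d n) (sine (d n)) k l = xz (p n ^+ 2 - m n ^+ 2) (2 * m n * p n) k l.
  by rewrite -ed -esi.
rewrite pE mE -es -ec.
have {}uv : (u n).1 ^+ 2 = 1 - (u n).2 ^+ 2 by rewrite -uv addrK.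
by case: k; case: l; rewrite !big_bool /R /xz /idop /= ?rmorphN /= ?ru ?rv; ring: uv.
Qed.

End Jordan.

(** * Filtering to qubits *)

Section QubitFilters.
Variable K : numClosedFieldType.
Local Notation r := (sqrtC (2 : K)).

Lemma tens_rank_form (I J T U : finType) (X : op K I) (Y : op K J)
    (f g : T -> I -> K) (f' g' : U -> J -> K) (w : I * J -> K) :
  (forall a b, X a b = \sum_t f t a * g t b) ->
  (forall a b, Y a b = \sum_u f' u a * g' u b) ->
  \sum_x \sum_y (w x)^* * tens X Y x y * w y =
  \sum_t \sum_u (\sum_x (w x)^* * (f t x.1 * f' u x.2)) * (\sum_y g t y.1 * g' u y.2 * w y).
Proof.
move=> XE YE.
under [RHS]eq_bigr => t _.
  under eq_bigr => u _ do rewrite big_distrlr /=.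
  rewrite exchange_big /=; under eq_bigr => x _ do rewrite exchange_big /=.
over.
rewrite [RHS]exchange_big /=; apply: eq_bigr => x _.
rewrite [RHS]exchange_big /=; apply: eq_bigr => y _.
rewrite /tens XE YE big_distrlr /= mulr_sumr mulr_suml; apply: eq_bigr => t _.
by rewrite mulr_sumr mulr_suml; apply: eq_bigr => u _; ring.
Qed.

(** The component of (V (x) V') w in the pair of qubits [n], [m]. *)
Definition block (N N' I J : finType) (V : N -> bool -> I -> K) (V' : N' -> bool -> J -> K)
    (w : I * J -> K) (n : N) (m : N') (i c : bool) : K :=
  \sum_x V n i x.1 * V' m c x.2 * w x.

Lemma tens_sandwich_form (N N' I J : finType) (V : N -> bool -> I -> K)
    (V' : N' -> bool -> J -> K) M M' (w : I * J -> K) :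
  let y := block V V' w in
  \sum_x \sum_y (w x)^* * tens (sandwich V M) (sandwich V' M') x y * w y =
  \sum_n \sum_m \sum_i \sum_c \sum_j \sum_d (y n m i c)^* * (M n i j * M' m c d) * y n m j d.
Proof.
pose f (L I0 : finType) (W : L -> bool -> I0 -> K) (t : L * bool * bool) x := (W t.1.1 t.1.2 x)^*.
pose g (L I0 : finType) (W : L -> bool -> I0 -> K) Q (t : L * bool * bool) x :=
  Q t.1.1 t.1.2 t.2 * W t.1.1 t.2 x.
have sE (L I0 : finType) (W : L -> bool -> I0 -> K) Q a b :
    sandwich W Q a b = \sum_t f _ _ W t a * g _ _ W Q t b.
  rewrite /sandwich !pair_bigA /=; apply: eq_bigr => t _; by rewrite mulrA.
rewrite /= (tens_rank_form w (sE _ _ V M) (sE _ _ V' M')).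
rewrite -(pair_bigA _ (fun p j => \sum_u (\sum_x (w x)^* * (f _ _ V (p, j) x.1 * f _ _ V' u x.2)) *
   (\sum_y g _ _ V M (p, j) y.1 * g _ _ V' M' u y.2 * w y))) /=.
rewrite -(pair_bigA _ (fun n i => \sum_j \sum_u
   (\sum_x (w x)^* * (f _ _ V (n, i, j) x.1 * f _ _ V' u x.2)) *
   (\sum_y g _ _ V M (n, i, j) y.1 * g _ _ V' M' u y.2 * w y))) /=.
apply: eq_bigr => n _.
transitivity (\sum_i \sum_j \sum_m \sum_c \sum_d (block V V' w n m i c)^* * (M n i j * M' m c d) *
    block V V' w n m j d); last first.
  rewrite !big_bool -!big_split /=; apply: eq_bigr => m _; rewrite !big_bool /=; ring.
apply: eq_bigr => i _; apply: eq_bigr => j _; rewrite [RHS]pair_bigA /= [RHS]pair_bigA /=.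
apply: eq_bigr => u _; rewrite /block rmorph_sum -mulrA mulr_sumr /=; congr (_ * _).
  by apply: eq_bigr => x _; rewrite /f !rmorphM /= mulrC.
by apply: eq_bigr => x _; rewrite /g /=; ring.
Qed.

Lemma isometric_norm (N N' I J : finType) (V : N -> bool -> I -> K)
    (V' : N' -> bool -> J -> K) (w : I * J -> K) :
  isometric V -> isometric V' ->
  \sum_x (w x)^* * w x =
  \sum_n \sum_m \sum_i \sum_c (block V V' w n m i c)^* * block V V' w n m i c.
Proof.
move=> iV iV'; transitivity (\sum_x \sum_y (w x)^* *
    tens (sandwich V (fun=> idop)) (sandwich V' (fun=> idop)) x y * w y).
  apply: eq_bigr => x _; rewrite -(sum_delta x (fun y => (w x)^* * w y)).
  under [RHS]eq_bigr => y _ do rewrite /tens iV iV' /idop -natrM mulnb.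
  apply: eq_bigr => y _; rewrite [_ && _](_ : _ = (y == x)); first by ring.
  by rewrite [RHS]eq_sym; case: x y => [x1 x2] [y1 y2]; rewrite xpair_eqE.
rewrite tens_sandwich_form; apply: eq_bigr => n _; apply: eq_bigr => m _.
by rewrite !big_bool /idop /=; ring.
Qed.

Lemma WopE (b : 'I_4) : exists s1 s2 s3 s4 : K,
  forall (A C : finType) (A0 A1 : op K A) (C0 C1 : op K C),
  Wop A0 A1 C0 C1 b = chsh A0 A1 C0 C1 s1 s2 s3 s4.
Proof.
case: b => -[|[|[|[|//]]]] hb; rewrite /Wop /=;
  [exists 1, 1, 1, (-1) | exists 1, 1, (-1), 1 | exists (-1), (-1), 1, (-1)
  | exists (-1), (-1), (-1), 1]; done.
Qed.

Lemma chsh_form (I J : finType) (A0 A1 : op K I) (C0 C1 : op K J) s1 s2 s3 s4 (w : I * J -> K) :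
  \sum_x \sum_y (w x)^* * chsh A0 A1 C0 C1 s1 s2 s3 s4 x y * w y =
  s1 * (\sum_x \sum_y (w x)^* * tens A0 C0 x y * w y) +
  s2 * (\sum_x \sum_y (w x)^* * tens A0 C1 x y * w y) +
  s3 * (\sum_x \sum_y (w x)^* * tens A1 C0 x y * w y) +
  s4 * (\sum_x \sum_y (w x)^* * tens A1 C1 x y * w y).
Proof.
rewrite !mulr_sumr -!big_split /=; apply: eq_bigr => x _.
rewrite !mulr_sumr -!big_split /=; apply: eq_bigr => y _.
by rewrite /chsh; ring.
Qed.

Lemma Wop_sandwich_form (N N' I J : finType) (V : N -> bool -> I -> K)
    (V' : N' -> bool -> J -> K) a0 a1 c0 c1 b (w : I * J -> K) (A0 A1 : op K I) (C0 C1 : op K J) :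
  (forall x y, A0 x y = sandwich V a0 x y) -> (forall x y, A1 x y = sandwich V a1 x y) ->
  (forall x y, C0 x y = sandwich V' c0 x y) -> (forall x y, C1 x y = sandwich V' c1 x y) ->
  let y := block V V' w in
  \sum_x \sum_y (w x)^* * Wop A0 A1 C0 C1 b x y * w y =
  \sum_n \sum_m \sum_i \sum_c \sum_j \sum_d
    (y n m i c)^* * Wop (a0 n) (a1 n) (c0 m) (c1 m) b (i, c) (j, d) * y n m j d.
Proof.
move=> hA0 hA1 hC0 hC1 /=; have [s1 [s2 [s3 [s4 WE]]]] := WopE b; rewrite WE chsh_form.
have tE X Y a c : (forall x y, X x y = sandwich V a x y) ->
    (forall x y, Y x y = sandwich V' c x y) ->
    \sum_x \sum_y (w x)^* * tens X Y x y * w y =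
    \sum_x \sum_y (w x)^* * tens (sandwich V a) (sandwich V' c) x y * w y.
  move=> hX hY; apply: eq_bigr => x _; apply: eq_bigr => y _.
  by rewrite /tens hX hY.
rewrite (tE A0 C0 a0 c0) // (tE A0 C1 a0 c1) // (tE A1 C0 a1 c0) // (tE A1 C1 a1 c1) //.
rewrite !tens_sandwich_form !mulr_sumr -!big_split /=; apply: eq_bigr => n _.
rewrite !mulr_sumr -!big_split /=; apply: eq_bigr => m _.
by rewrite !WE !big_bool /chsh /tens /=; ring.
Qed.

(** Kraus operators composed with a frame; the Kraus index joins the block index. *)
Definition dephased (N I : finType) (V : N -> bool -> I -> K) (k : N -> bool -> bool -> bool -> K)
    (t : N * bool) (i : bool) (x : I) : K := \sum_j k t.1 t.2 i j * V t.1 j x.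

Lemma dephased_isometric (N I : finType) (V : N -> bool -> I -> K) k : isometric V ->
  (forall n i j, \sum_l \sum_i' (k n l i' i)^* * k n l i' j = idop i j) ->
  isometric (dephased V k).
Proof.
move=> iV kk x y; rewrite -iV /sandwich.
rewrite -(pair_bigA _ (fun n l => \sum_i \sum_j (dephased V k (n, l) i x)^* * idop i j *
   dephased V k (n, l) j y)) /=.
apply: eq_bigr => n _.
under [RHS]eq_bigr => i _ do under eq_bigr => j _ do rewrite -(kk n).
by rewrite /dephased !big_bool /= !rmorphD !rmorphM /idop /=; ring.
Qed.

Lemma krausA_isometric (c s : K) : angle c s ->
  forall i j, \sum_l \sum_i' (krausA c s l i' i)^* * krausA c s l i' j = idop i j.
Proof.
move=> acs; have /andP[g0 g1] := visibility_bounds acs; have [_ rs _ _] := acs.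
have [_ e2] := sign_ofP rs; have /CrealP re := sign_of_real s.
have p0 : 0 <= sqrtC ((1 + visibility c) / 2) by rewrite sqrtC_ge0 divr_ge0 ?addr_ge0 ?ler01 ?ler0n.
have m0 : 0 <= sqrtC ((1 - visibility c) / 2) by rewrite sqrtC_ge0 divr_ge0 ?subr_ge0 ?ler0n.
have M2 : sqrtC ((1 - visibility c) / 2) ^+ 2 = 1 - sqrtC ((1 + visibility c) / 2) ^+ 2.
  by rewrite !sqrtCK; field.
move: p0 m0 M2; rewrite /krausA.
move: (sqrtC ((1 + _) / 2)) (sqrtC ((1 - _) / 2)) => P M.
move=> /ger0_real/CrealP rP /ger0_real/CrealP rM M2.
have r2 : r ^+ 2 = 2 := sqrt2_sqr K; have rn0 : r != 0 by rewrite sqrtC_eq0 pnatr_eq0.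
have rr : (r^-1)^* = r^-1 by apply/CrealP; rewrite realV ger0_real ?sqrt2_ge0.
by move=> i j; case: i; case: j; rewrite !big_bool /xz /idop /=
  !(rmorphM, rmorphN, rmorph0, rmorph1) /= ?rP ?rM ?re ?rr; field: r2 M2 e2.
Qed.

Lemma krausC_isometric (d t : K) : angle d t ->
  forall i j, \sum_l \sum_i' (krausC d t l i' i)^* * krausC d t l i' j = idop i j.
Proof.
move=> adt; have /andP[g0 g1] := visibility_bounds adt.
have p0 : 0 <= sqrtC ((1 + visibility d) / 2) by rewrite sqrtC_ge0 divr_ge0 ?addr_ge0 ?ler01 ?ler0n.
have m0 : 0 <= sqrtC ((1 - visibility d) / 2) by rewrite sqrtC_ge0 divr_ge0 ?subr_ge0 ?ler0n.
have M2 : sqrtC ((1 - visibility d) / 2) ^+ 2 = 1 - sqrtC ((1 + visibility d) / 2) ^+ 2.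
  by rewrite !sqrtCK; field.
move: p0 m0 M2; rewrite /krausC.
move: (sqrtC ((1 + _) / 2)) (sqrtC ((1 - _) / 2)) => P M.
move=> /ger0_real/CrealP rP /ger0_real/CrealP rM M2.
by move=> i j; case: i; case: j; case: ifP => _; rewrite !big_bool /xz /idop /=
  !(rmorphM, rmorphN, rmorph0, rmorph1) /= ?rP ?rM; field: M2.
Qed.

(** Both sides split into sums over pairs of blocks, where the block inequality applies. The form
    for vectors [w] is the one needed for Gram vectors of conditional states. *)
Lemma qubit_filters (A C : finType) (A0 A1 : op K A) (C0 C1 : op K C) :
  observable A0 -> observable A1 -> observable C0 -> observable C1 ->
  exists (N N' : finType) (T : N -> bool -> A -> K) (T' : N' -> bool -> C -> K),
  [/\ isometric T, isometric T' & forall (b : 'I_4) (w : A * C -> K),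
  (4 + 5 * r) / 16 * (\sum_x \sum_y (w x)^* * Wop A0 A1 C0 C1 b x y * w y)
   - (1 + 2 * r) / 4 * (\sum_x (w x)^* * w x) <=
  \sum_n \sum_m `|\sum_i \sum_c (bell_amp b (i, c))^* * block T T' w n m i c| ^+ 2].
Proof.
move=> hA0 hA1 hC0 hC1.
have [V [c [s [acs iV VA0 VA1]]]] := frameA hA0 hA1.
have [V' [d [t [adt iV' VC0 VC1]]]] := frameC hC0 hC1.
pose k n := krausA (c n) (s n); pose k' m := krausC (d m) (t m).
exists _, _, (dephased V k), (dephased V' k'); split.
- by apply: dephased_isometric => // n; apply: krausA_isometric.
- by apply: dephased_isometric => // n; apply: krausC_isometric.
move=> b w; rewrite (Wop_sandwich_form b w VA0 VA1 VC0 VC1) (isometric_norm w iV iV') /=.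
set y := block V V' w.
have ovE n l m l' : \sum_i \sum_c0 (bell_amp b (i, c0))^* *
      block (dephased V k) (dephased V' k') w (n, l) (m, l') i c0 =
    overlap b (k n l) (k' m l') (y n m).
  apply: eq_bigr => i _; apply: eq_bigr => c0 _; congr (_ * _).
  rewrite /block /dephased /= !big_bool /= /y /block !mulr_sumr -!big_split /=.
  by apply: eq_bigr => x _; rewrite !big_bool /=; ring.
rewrite -(pair_bigA _ (fun n l => \sum_u `|\sum_i \sum_c0 (bell_amp b (i, c0))^* *
      block (dephased V k) (dephased V' k') w (n, l) u i c0| ^+ 2)) /=.
rewrite !mulr_sumr -sumrB; apply: ler_sum => n _.
have -> : \sum_l \sum_u `|\sum_i \sum_c0 (bell_amp b (i, c0))^* *
      block (dephased V k) (dephased V' k') w (n, l) u i c0| ^+ 2 =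
   \sum_m \sum_l \sum_l' `|overlap b (k n l) (k' m l') (y n m)| ^+ 2.
  rewrite [RHS]exchange_big /=; apply: eq_bigr => l _; rewrite pair_bigA /=.
  by apply: eq_bigr => -[m l'] _; rewrite ovE.
rewrite !mulr_sumr -sumrB; apply: ler_sum => m _.
exact: block_inequality.
Qed.

End QubitFilters.

(** * Steered states *)

Section Swapping.
Variable K : numClosedFieldType.
Implicit Types A B C I J : finType.

(** The conditional state before normalization, of trace p_b; working with it avoids dividing by
    p_b. *)
Definition steered A B1 B2 C (t1 : op K (A * B1)%type) (t2 : op K (B2 * C)%type)
    (X : op K (B1 * B2)%type) : op K (A * C)%type :=
  ptr_mid (mulop (embB X) (prod_state t1 t2)).

Lemma steeredE A B1 B2 C (t1 : op K (A * B1)%type) (t2 : op K (B2 * C)%type)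
    (X : op K (B1 * B2)%type) x y :
  steered t1 t2 X x y = \sum_m \sum_m' X m m' *
    (t1 (x.1, m'.1) (y.1, m.1) * t2 (m'.2, x.2) (m.2, y.2)).
Proof.
apply: eq_bigr => m _; rewrite /mulop.
rewrite -(pair_bigA _ (fun p c => embB X (x.1, m, x.2) (p, c) *
  prod_state t1 t2 (p, c) (y.1, m, y.2))) /=.
rewrite -(pair_bigA _ (fun a m' => \sum_c embB X (x.1, m, x.2) (a, m', c) *
  prod_state t1 t2 (a, m', c) (y.1, m, y.2))) /=.
transitivity (\sum_a (a == x.1)%:R * \sum_m' \sum_c (c == x.2)%:R *
   (X m m' * (t1 (a, m'.1) (y.1, m.1) * t2 (m'.2, c) (m.2, y.2)))).
  apply: eq_bigr => a _; rewrite mulr_sumr; apply: eq_bigr => m' _.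
  rewrite mulr_sumr; apply: eq_bigr => c _.
  rewrite /embB /tens /prod_state /idop /= [x.1 == a]eq_sym [x.2 == c]eq_sym; ring.
by rewrite sum_delta; apply: eq_bigr => m' _; rewrite sum_delta.
Qed.

Lemma sum_pair I J (F : I * J -> K) : \sum_x F x = \sum_i \sum_j F (i, j).
Proof. by rewrite pair_bigA; apply: eq_bigr => -[]. Qed.

Lemma sum_regroup I J (F : I -> I -> J -> J -> K) :
  \sum_p \sum_q F p.1 p.2 q.1 q.2 = \sum_x \sum_y F x.1 y.1 x.2 y.2.
Proof.
rewrite !sum_pair; apply: eq_bigr => a _ /=.
under eq_bigr => b _ do rewrite sum_pair /=.
under [RHS]eq_bigr => c _ do rewrite sum_pair /=.
by rewrite exchange_big.
Qed.

Lemma steered_psd A B1 B2 C (t1 : op K (A * B1)%type) (t2 : op K (B2 * C)%type)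
    (X : op K (B1 * B2)%type) : psd t1 -> psd t2 -> psd X -> psd (steered t1 t2 X).
Proof.
move=> /psd_gram[g gE] /psd_gram[g' gE'] /psd_gram[h hE].
pose G (t : (B1 * B2) * (A * B1) * (B2 * C)) (y : A * C) : K :=
  \sum_m (h t.1.1 m)^* * (g t.1.2 (y.1, m.1) * g' t.2 (m.2, y.2)).
apply: (@gram_psd _ _ _ G) => x y; rewrite steeredE.
under [RHS]eq_bigr => t _ do rewrite /G rmorph_sum big_distrlr /=.
rewrite [RHS]exchange_big [LHS]exchange_big /=; apply: eq_bigr => m' _.
rewrite [RHS]exchange_big /=; apply: eq_bigr => m _.
rewrite hE gE gE' mulrA [X in X * _]big_distrlr /= pair_bigA big_distrlr /= pair_bigA /=.
by apply: eq_bigr => t _; rewrite !rmorphM /= conjCK; ring.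
Qed.

(** Operations on A alone commute with steering. Stating this entrywise lets it serve both the qubit
    filters and the later rescaling. *)
Lemma steered_lin1 A A' B1 B2 C (T : finType) (t1 : op K (A * B1)%type) (t1' : op K (A' * B1)%type)
    (t2 : op K (B2 * C)%type) X (k : T -> K) (u v : T -> A) i c j d :
  (forall m m', t1' (i, m) (j, m') = \sum_t k t * t1 (u t, m) (v t, m')) ->
  steered t1' t2 X (i, c) (j, d) = \sum_t k t * steered t1 t2 X (u t, c) (v t, d).
Proof.
move=> e; rewrite steeredE /=.
under [RHS]eq_bigr => t _.
  rewrite steeredE /= mulr_sumr; under eq_bigr => m _ do rewrite mulr_sumr; over.
rewrite [RHS]exchange_big /=; apply: eq_bigr => m _.
rewrite [RHS]exchange_big /=; apply: eq_bigr => m' _.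
by rewrite e mulr_suml mulr_sumr; apply: eq_bigr => t _; ring.
Qed.

Lemma steered_lin2 A B1 B2 C C' (T : finType) (t1 : op K (A * B1)%type) (t2 : op K (B2 * C)%type)
    (t2' : op K (B2 * C')%type) X (k : T -> K) (u v : T -> C) i c j d :
  (forall m m', t2' (m, c) (m', d) = \sum_t k t * t2 (m, u t) (m', v t)) ->
  steered t1 t2' X (i, c) (j, d) = \sum_t k t * steered t1 t2 X (i, u t) (j, v t).
Proof.
move=> e; rewrite steeredE /=.
under [RHS]eq_bigr => t _.
  rewrite steeredE /= mulr_sumr; under eq_bigr => m _ do rewrite mulr_sumr; over.
rewrite [RHS]exchange_big /=; apply: eq_bigr => m _.
rewrite [RHS]exchange_big /=; apply: eq_bigr => m' _.
by rewrite e !mulr_sumr; apply: eq_bigr => t _; ring.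
Qed.

Lemma prob_steered A B1 B2 C (t1 : op K (A * B1)%type) (t2 : op K (B2 * C)%type) X :
  prob (prod_state t1 t2) X = trop (steered t1 t2 X).
Proof.
rewrite /prob /trop /steered /ptr_mid.
set F := mulop _ _.
rewrite -(pair_bigA _ (fun p c => F (p, c) (p, c))) /=.
rewrite -(pair_bigA _ (fun a m => \sum_c F (a, m, c) (a, m, c))) /=.
rewrite -(pair_bigA _ (fun a c => \sum_m F (a, m, c) (a, m, c))) /=.
by apply: eq_bigr => a _; rewrite exchange_big.
Qed.

Definition filter1 (N I J B : finType) (T : N -> J -> I -> K) (t : op K (I * B)%type)
    : op K (J * B)%type :=
  fun x y => \sum_n \sum_p T n x.1 p.1 * (T n y.1 p.2)^* * t (p.1, x.2) (p.2, y.2).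
Definition filter2 (N I J B : finType) (T : N -> J -> I -> K) (t : op K (B * I)%type)
    : op K (B * J)%type :=
  fun x y => \sum_n \sum_p T n x.2 p.1 * (T n y.2 p.2)^* * t (x.1, p.1) (y.1, p.2).

Lemma filter1_psd (N I J B : finType) (T : N -> J -> I -> K) (t : op K (I * B)%type) :
  psd t -> psd (filter1 T t).
Proof.
move=> /psd_gram[g gE].
pose G (s : N * (I * B)) (y : J * B) : K := \sum_a (T s.1 y.1 a)^* * g s.2 (a, y.2).
apply: (@gram_psd _ _ _ G) => x y.
rewrite -(pair_bigA _ (fun n k => (G (n, k) x)^* * G (n, k) y)) /=.
apply: eq_bigr => n _; under [RHS]eq_bigr => k _ do rewrite /G rmorph_sum big_distrlr pair_bigA /=.
rewrite [RHS]exchange_big /=; apply: eq_bigr => p _; rewrite gE mulr_sumr.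
by apply: eq_bigr => k _; rewrite rmorphM /= conjCK; ring.
Qed.

Lemma filter2_psd (N I J B : finType) (T : N -> J -> I -> K) (t : op K (B * I)%type) :
  psd t -> psd (filter2 T t).
Proof.
move=> /psd_gram[g gE].
pose G (s : N * (B * I)) (y : B * J) : K := \sum_a (T s.1 y.2 a)^* * g s.2 (y.1, a).
apply: (@gram_psd _ _ _ G) => x y.
rewrite -(pair_bigA _ (fun n k => (G (n, k) x)^* * G (n, k) y)) /=.
apply: eq_bigr => n _; under [RHS]eq_bigr => k _ do rewrite /G rmorph_sum big_distrlr pair_bigA /=.
rewrite [RHS]exchange_big /=; apply: eq_bigr => p _; rewrite gE mulr_sumr.
by apply: eq_bigr => k _; rewrite rmorphM /= conjCK; ring.
Qed.

Lemma isometric_trace (N I : finType) (T : N -> bool -> I -> K) (F : I -> I -> K) : isometric T ->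
  \sum_i \sum_n \sum_p T n i p.1 * (T n i p.2)^* * F p.1 p.2 = \sum_a F a a.
Proof.
move=> iT; transitivity (\sum_p idop p.2 p.1 * F p.1 p.2).
  rewrite exchange_big /=; under eq_bigr => n _ do rewrite exchange_big /=.
  rewrite exchange_big /=; apply: eq_bigr => p _; rewrite -iT /sandwich mulr_suml.
  by apply: eq_bigr => n _; rewrite !big_bool /idop /=; ring.
rewrite -(pair_bigA _ (fun a b => idop b a * F a b)) /=; apply: eq_bigr => a _.
by rewrite /idop sum_delta.
Qed.

Lemma filter1_trace (N I B : finType) (T : N -> bool -> I -> K) (t : op K (I * B)%type) :
  isometric T -> trop (filter1 T t) = trop t.
Proof.
move=> iT; rewrite /trop !sum_pair exchange_big [RHS]exchange_big /=.
apply: eq_bigr => b _; exact: (isometric_trace (fun a a' => t (a, b) (a', b)) iT).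
Qed.

Lemma filter2_trace (N I B : finType) (T : N -> bool -> I -> K) (t : op K (B * I)%type) :
  isometric T -> trop (filter2 T t) = trop t.
Proof.
move=> iT; rewrite /trop !sum_pair.
apply: eq_bigr => b _; exact: (isometric_trace (fun a a' => t (b, a) (b, a')) iT).
Qed.

(** Each Gram vector is pushed through all pairs of Kraus operators, giving the amplitudes bounded
    in [qubit_filters]. In the Gram form the ket is the conjugate of [g k], whence the
    conjugations. *)
Lemma steered_filter (N N' A B1 B2 C : finType) (T : N -> bool -> A -> K) (T' : N' -> bool -> C -> K)
    (t1 : op K (A * B1)%type) (t2 : op K (B2 * C)%type) X (J : finType) (g : J -> A * C -> K) :
  (forall x y, steered t1 t2 X x y = \sum_k (g k x)^* * g k y) ->
  forall x y, steered (filter1 T t1) (filter2 T' t2) X x y =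
    \sum_(s : N * N' * J)
       (let h z := (block T T' (fun w => (g s.2 w)^* ) s.1.1 s.1.2 z.1 z.2)^* in (h x)^* * h y).
Proof.
move=> gE [i c] [j d].
rewrite (@steered_lin1 A _ _ _ _ (N * (A * A))%type t1 _ _ _
   (fun s => T s.1 i s.2.1 * (T s.1 j s.2.2)^* ) (fun s => s.2.1) (fun s => s.2.2)); last first.
  by move=> m m'; rewrite /filter1 pair_bigA.
under eq_bigr => s _.
  rewrite (@steered_lin2 _ _ _ C _ (N' * (C * C))%type t1 t2 _ _
   (fun s => T' s.1 c s.2.1 * (T' s.1 d s.2.2)^* ) (fun s => s.2.1) (fun s => s.2.2)); last first.
    by move=> m m'; rewrite /filter2 pair_bigA.
over.
rewrite /= !sum_pair /=; apply: eq_bigr => n _.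
under eq_bigr => p _ do rewrite sum_pair mulr_sumr /=.
rewrite exchange_big /=; apply: eq_bigr => m _.
under eq_bigr => p _ do rewrite mulr_sumr /=.
rewrite (sum_regroup (fun a a' e e' => T n i a * (T n j a')^* *
   (T' m c e * (T' m d e')^* * steered t1 t2 X (a, e) (a', e')))).
under [RHS]eq_bigr => k _ do rewrite conjCK /block rmorph_sum big_distrlr /=.
rewrite [RHS]exchange_big /=; apply: eq_bigr => x _.
rewrite [RHS]exchange_big /=; apply: eq_bigr => y _.
rewrite -!surjective_pairing gE !mulr_sumr; apply: eq_bigr => k _.
by rewrite !rmorphM /= conjCK; ring.
Qed.

End Swapping.

(** * Fidelity after filtering *)

Section Fidelity.
Variable K : numClosedFieldType.
Local Notation r := (sqrtC (2 : K)).

Lemma steered_sum (A B1 B2 C L : finType) (t1 : op K (A * B1)%type) (t2 : op K (B2 * C)%type)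
    (Bm : L -> op K (B1 * B2)%type) x y : povm Bm ->
  \sum_b steered t1 t2 (Bm b) x y =
  (\sum_m t1 (x.1, m) (y.1, m)) * (\sum_m t2 (m, x.2) (m, y.2)).
Proof.
case=> _ sB; under eq_bigr => b _ do rewrite steeredE.
rewrite exchange_big /= [RHS]big_distrlr [RHS]pair_bigA /=; apply: eq_bigr => m _.
rewrite exchange_big /=.
under eq_bigr => m' _ do rewrite -mulr_suml sB /idop eq_sym.
by rewrite sum_delta.
Qed.

Lemma trop_ge0 (I : finType) (X : op K I) : psd X -> 0 <= trop X.
Proof.
move=> /psd_gram[g gE]; apply: sumr_ge0 => x _; rewrite gE; apply: sumr_ge0 => k _.
by rewrite mulrC mul_conjC_ge0.
Qed.

Lemma filtered_fidelity (A B1 B2 C : finType)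
    (t1 : op K (A * B1)%type) (t2 : op K (B2 * C)%type) (Bm : 'I_4 -> op K (B1 * B2)%type)
    (A0 A1 : op K A) (C0 C1 : op K C) :
  density t1 -> density t2 -> povm Bm ->
  observable A0 -> observable A1 -> observable C0 -> observable C1 ->
  exists (N N' : finType) (T : N -> bool -> A -> K) (T' : N' -> bool -> C -> K),
  [/\ isometric T, isometric T' &
   (4 + 5 * r) / 16 * beta_ave (prod_state t1 t2) Bm A0 A1 C0 C1 - (1 + 2 * r) / 4 <=
   \sum_b qform (steered (filter1 T t1) (filter2 T' t2) (Bm b)) (bell_amp b)].
Proof.
move=> [p1 tr1] [p2 tr2] pB hA0 hA1 hC0 hC1.
have [N [N' [T [T' [iT iT' ext]]]]] := qubit_filters hA0 hA1 hC0 hC1.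
exists N, N', T, T'; split=> //.
pose Om b := steered t1 t2 (Bm b).
have pOm b : psd (Om b) by apply: steered_psd => //; case: pB.
have sp : \sum_b trop (Om b) = 1.
  rewrite /trop exchange_big /=; under eq_bigr => x _ do rewrite steered_sum //.
  rewrite sum_pair /= -big_distrlr /= -[1]mulr1 -{1}tr1 -tr2 /trop !sum_pair; congr (_ * _).
  by rewrite exchange_big.
(* The constant is spread over the outcomes with weights p_b, so that the inequality is proved
   outcome by outcome. *)
have -> : (1 + 2 * r) / 4 = (1 + 2 * r) / 4 * \sum_b trop (Om b) by rewrite sp mulr1.
rewrite /beta_ave big_mkcond /= !mulr_sumr -sumrB.
apply: ler_sum => b _; rewrite prob_steered -/(Om b).
have [g gE] := psd_gram (pOm b).
have qE : qform (steered (filter1 T t1) (filter2 T' t2) (Bm b)) (bell_amp b) =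
    \sum_k \sum_n \sum_m
      `|\sum_i \sum_c (bell_amp b (i, c))^* * block T T' (fun w => (g k w)^* ) n m i c| ^+ 2.
  rewrite (qform_gram _ (steered_filter T T' gE)) [LHS]sum_pair [LHS]sum_pair /=.
  rewrite [RHS]exchange_big /=; apply: eq_bigr => n _.
  rewrite [RHS]exchange_big /=; apply: eq_bigr => m _; apply: eq_bigr => k _.
  rewrite -[in RHS]norm_conjC sum_pair rmorph_sum; congr (`|_| ^+ 2).
  apply: eq_bigr => i _; rewrite rmorph_sum; apply: eq_bigr => c _ /=.
  by rewrite rmorphM /= conjCK mulrC.
have trE : trop (Om b) = \sum_k \sum_x (g k x)^*^* * (g k x)^*.
  rewrite exchange_big; apply: eq_bigr => x _; rewrite gE; apply: eq_bigr => k _ /=.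
  by rewrite conjCK mulrC.
have WE : \sum_k \sum_x \sum_y (g k x)^*^* * Wop A0 A1 C0 C1 b x y * (g k y)^* =
    \sum_x \sum_y Wop A0 A1 C0 C1 b x y * Om b y x.
  rewrite exchange_big; apply: eq_bigr => x _; rewrite exchange_big; apply: eq_bigr => y _ /=.
  by rewrite gE mulr_sumr; apply: eq_bigr => k _; rewrite conjCK; ring.
case: ifPn => [p0 | np0].
  have -> : trop (Om b) * trop (mulop (Wop A0 A1 C0 C1 b) (cond_state (prod_state t1 t2) (Bm b))) =
     \sum_x \sum_y Wop A0 A1 C0 C1 b x y * Om b y x.
    have pn0 := lt0r_neq0 p0; rewrite /cond_state prob_steered -/(Om b).
    move: (trop (Om b)) pn0 => p pn0.
    rewrite mulr_sumr; apply: eq_bigr => x _; rewrite mulr_sumr; apply: eq_bigr => y _.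
    by rewrite /scaleop -/(steered t1 t2 (Bm b)) -/(Om b); field.
  rewrite -WE trE qE !mulr_sumr -sumrB; apply: ler_sum => k _; exact: ext.
(* An outcome left out of [beta_ave] has p_b = 0, and its fidelity term is nonnegative. *)
have -> : trop (Om b) = 0.
  by apply/eqP; move: np0; rewrite lt_def trop_ge0 // andbT negbK.
rewrite !mulr0 subr0 qE; apply: sumr_ge0 => k _; apply: sumr_ge0 => n _.
by apply: sumr_ge0 => m _; rewrite exprn_ge0.
Qed.

Lemma gfunE (beta : K) : gfun beta = (4 + 5 * r) / 16 * beta - (1 + 2 * r) / 4.
Proof.
have r2 : r ^+ 2 = 2 := sqrt2_sqr K.
rewrite /gfun /xstar.
have -> : 2 * r - (16 + 14 * r) / 17 = (20 * r - 16) / 17 by field.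
have nz : 20 * r - 16 != 0.
  apply/eqP => /eqP; rewrite subr_eq0 => /eqP e.
  have : (20 * r) ^+ 2 = 16 ^+ 2 by rewrite e.
  rewrite exprMn r2 => /eqP; rewrite -!natrX -natrM eqr_nat; done.
by field: r2.
Qed.

End Fidelity.

(** * Unital maps and their quality *)

Section Channels.
Variable K : numClosedFieldType.

(* The map with Choi operator [k], up to transposition. *)
Definition chan (J B : finType) (k : op K (J * B)%type) (X : op K B) : op K J :=
  fun i j => \sum_b \sum_b' X b b' * k (j, b') (i, b).

Definition swapop (J B : finType) (k : op K (B * J)%type) : op K (J * B)%type :=
  fun x y => k (x.2, x.1) (y.2, y.1).

Lemma swapop_psd (J B : finType) (k : op K (B * J)%type) : psd k -> psd (swapop k).
Proof.
move=> /psd_gram[g gE]; apply: (@gram_psd _ _ _ (fun n x => g n (x.2, x.1))) => x y.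
exact: gE.
Qed.

Lemma opP (I : finType) (X Y : op K I) : (forall i j, X i j = Y i j) -> X = Y.
Proof. by move=> e; apply: functional_extensionality => i; apply: functional_extensionality. Qed.

Lemma chan_cp (J B : finType) (k : op K (J * B)%type) : psd k -> cp_map (chan k).
Proof.
move=> /psd_gram[g gE]; split=> [a X Y | n X pX].
  apply: opP => i j; rewrite /chan mulr_sumr -big_split; apply: eq_bigr => b _ /=.
  by rewrite mulr_sumr -big_split; apply: eq_bigr => b' _ /=; ring.
have [h hE] := psd_gram pX.
pose G (s : ('I_n * B) * (J * B)) (x : 'I_n * J) : K :=
  \sum_b h s.1 (x.1, b) * (g s.2 (x.2, b))^*.
apply: (@gram_psd _ _ _ G) => x y; rewrite /ampl /chan.
under [RHS]eq_bigr => s _ do rewrite /G rmorph_sum big_distrlr /=.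
rewrite [RHS]exchange_big /=; apply: eq_bigr => b _.
rewrite [RHS]exchange_big /=; apply: eq_bigr => b' _.
rewrite hE gE big_distrlr /= pair_bigA; apply: eq_bigr => s _ /=.
by rewrite rmorphM /= conjCK; ring.
Qed.

Lemma chan_unital (J B : finType) (k : op K (J * B)%type) :
  (forall i j, \sum_b k (i, b) (j, b) = idop i j) -> unital (chan k).
Proof.
move=> e; apply: opP => i j; rewrite /chan.
under eq_bigr => b _.
  under eq_bigr => b' _ do rewrite /idop eq_sym.
  rewrite sum_delta; over.
by rewrite e /idop eq_sym.
Qed.

Lemma bell_amp_conj b x : (@bell_amp K b x)^* = bell_amp b x.
Proof.
have rr : (sqrtC (2 : K))^-1^* = (sqrtC 2)^-1.
  by apply/CrealP; rewrite realV ger0_real ?sqrt2_ge0.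
by case: b x => -[|[|[|[|//]]]] hb [[] []]; rewrite /bell_amp /= ?rmorphN ?rmorph0 /= ?rr.
Qed.

(** The two maps pull an effect back to the transpose of the operator steered by their Choi
    operators; the Bell amplitudes are real, so the transposition does not affect the pairing. *)
Lemma quality_steered (B1 B2 : finType) (k1 : op K (bool * B1)%type) (k2 : op K (B2 * bool)%type)
    (Bm : 'I_4 -> op K (B1 * B2)%type) :
  quality_val Bm (@bell K) (chan k1) (chan (swapop k2)) =
  (2 * 2)^-1 * \sum_b qform (steered k1 k2 (Bm b)) (bell_amp b).
Proof.
rewrite /quality_val card_bool; congr (_ * _); apply: eq_bigr => b _.
rewrite /qform exchange_big /=; apply: eq_bigr => x _; apply: eq_bigr => y _.
have -> : tens_map (chan k1) (chan (swapop k2)) (Bm b) x y = steered k1 k2 (Bm b) y x.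
  rewrite steeredE /tens_map /chan /swapop /= sum_pair.
  under [RHS]eq_bigr => s _ do under eq_bigr => u _ do rewrite sum_pair /=.
  rewrite [RHS]exchange_big /=; apply: eq_bigr => u _.
  under [RHS]eq_bigr => s _ do rewrite exchange_big /=.
  rewrite [RHS]exchange_big /=; apply: eq_bigr => v _.
  rewrite mulr_suml; apply: eq_bigr => s _; rewrite mulr_suml; apply: eq_bigr => t _.
  by rewrite mulrA.
by rewrite /bell !bell_amp_conj; ring.
Qed.

(** The operator with eigenvalues [u] in the basis given by [E], acting on the first factor. *)
Definition spectral_scale (E : bool -> bool -> K) (u : bool -> K) (v : bool * bool -> K)
    (x : bool * bool) : K :=
  \sum_n \sum_j (E n x.1)^* * u n * E n j * v (j, x.2).

Definition max_entangled (v : bool * bool -> K) : Prop :=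
  forall i j, \sum_c v (i, c) * (v (j, c))^* = idop i j / 2.

Lemma bell_max_entangled b : max_entangled (@bell_amp K b).
Proof.
have r2 := sqrt2_sqr K; have rn0 : sqrtC (2 : K) != 0 by rewrite sqrtC_eq0 pnatr_eq0.
move=> i j; rewrite big_bool !bell_amp_conj.
case: b i j => -[|[|[|[|//]]]] hb [] []; rewrite /bell_amp /idop /=; by field: r2.
Qed.

(** [X k n] pairs the k-th Gram vector with the n-th spectral component of [v]. That component has
    squared norm 1/2 because [v] is maximally entangled, and Cauchy-Schwarz over the second factor
    gives the bound. *)
Lemma spectral_split (M : op K (bool * bool)%type) (E : bool -> bool -> K) (v : bool * bool -> K) :
  psd M -> (forall n m, \sum_x E n x * (E m x)^* = (n == m)%:R) -> max_entangled v ->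
  exists X : bool * bool -> bool -> K,
   (forall u, qform M (spectral_scale E u v) = \sum_k `|\sum_n u n * X k n| ^+ 2) /\
   (forall n, \sum_k `|X k n| ^+ 2 <=
      2^-1 * \sum_c \sum_i \sum_j E n i * M (i, c) (j, c) * (E n j)^* ).
Proof.
move=> /psd_gram[g gE] EE mv.
exists (fun k n => \sum_c (\sum_i g k (i, c) * (E n i)^* ) * (\sum_j E n j * v (j, c))).
split=> [u | n].
  rewrite (qform_gram _ gE); apply: eq_bigr => k _; congr (`|_| ^+ 2).
  by rewrite sum_pair /spectral_scale !big_bool /=; ring.
pose al k c := \sum_i g k (i, c) * (E n i)^*; pose be c := \sum_j E n j * v (j, c).
have be1 : \sum_c be c * (be c)^* = 2^-1.
  transitivity (\sum_i \sum_j E n i * (E n j)^* * (\sum_c v (i, c) * (v (j, c))^* )).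
    by rewrite /be !big_bool /= !rmorphD !rmorphM /=; ring.
  under eq_bigr => i _ do under eq_bigr => j _ do rewrite mv.
  have e1 : E n true * (E n true)^* = 1 - E n false * (E n false)^*.
    by apply/(canRL (addrK _)); have := EE n n; rewrite eqxx big_bool.
  by rewrite !big_bool /idop /=; field: e1.
have cs k : `|\sum_c al k c * be c| ^+ 2 <= 2^-1 * \sum_c al k c * (al k c)^*.
  rewrite -be1 -subr_ge0 normCK !big_bool /= !rmorphD !rmorphM /=.
  set z := _ - _; have -> : z = (al k true * (be false)^* - al k false * (be true)^* ) *
     (al k true * (be false)^* - al k false * (be true)^* )^*.
    by rewrite /z rmorphB !rmorphM /= !conjCK; ring.
  exact: mul_conjC_ge0.
apply: le_trans (_ : \sum_k 2^-1 * \sum_c al k c * (al k c)^* <= _).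
  by apply: ler_sum => k _; apply: cs.
rewrite -mulr_sumr exchange_big /= le_eqVlt; apply/orP; left; apply/eqP; congr (_ * _).
apply: eq_bigr => c _; under eq_bigr => k _ do rewrite rmorph_sum mulrC big_distrlr /=.
rewrite exchange_big /=; apply: eq_bigr => i _; rewrite exchange_big /=; apply: eq_bigr => j _.
rewrite gE mulr_sumr mulr_suml; apply: eq_bigr => k _; rewrite rmorphM /= conjCK; ring.
Qed.

Lemma eigenvalue_product_ge (R : realFieldType) (a b q : R) : 0 <= a -> 0 <= b -> a + b = 1 ->
  1 / 2 < q -> (forall p, 0 <= p -> p * q * 2 <= (p + 1) * (a + p * b)) ->
  (2 * q - 1) ^+ 2 <= 4 * (a * b).
Proof.
move=> a0 b0 ab q2 h; have e : 0 < 2 * q - 1 by lra.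
have {}h p : 0 <= p -> p * (2 * q - 1) <= a + p ^+ 2 * b.
  move=> p0; have := h p p0.
  have -> : (p + 1) * (a + p * b) = a + p ^+ 2 * b + p * (a + b) by ring.
  rewrite ab; lra.
have [b1 | b1] := eqVneq b 0.
  have p0 : 0 <= 2 / (2 * q - 1) by rewrite divr_ge0 // ltW.
  have := h _ p0; rewrite b1 mulr0 addr0 divfK ?gt_eqF //; lra.
have bp : 0 < b by rewrite lt0r b1.
(* This p minimizes a + p^2 b - p (2 q - 1). *)
have p0 : 0 <= (2 * q - 1) / (2 * b) by rewrite divr_ge0 ?mulr_ge0 // ltW.
have := h _ p0; rewrite -(ler_pM2l bp).
have -> : b * ((2 * q - 1) / (2 * b) * (2 * q - 1)) = (2 * q - 1) ^+ 2 / 2 by field.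
have -> : b * (a + ((2 * q - 1) / (2 * b)) ^+ 2 * b) = a * b + (2 * q - 1) ^+ 2 / 4 by field.
lra.
Qed.

End Channels.

(** * Spectra of the marginals *)

Section Marginals.
Variable K : numClosedFieldType.

Lemma qform_ext (I : finType) (X : op K I) (v w : I -> K) :
  (forall x, v x = w x) -> qform X v = qform X w.
Proof. by move=> e; apply: eq_bigr => x _; apply: eq_bigr => y _; rewrite !e. Qed.

Lemma spectral_scale1 (E : bool -> bool -> K) (v : bool * bool -> K) x :
  (forall x y, \sum_n (E n x)^* * E n y = (x == y)%:R) ->
  spectral_scale E (fun=> 1) v x = v x.
Proof.
move=> EtE; case: x => i c; rewrite /spectral_scale exchange_big /=.
transitivity (\sum_j (j == i)%:R * v (j, c)); last by rewrite sum_delta.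
apply: eq_bigr => j _; rewrite eq_sym -EtE mulr_suml; apply: eq_bigr => n _.
by rewrite mulr1.
Qed.

(** Summed over outcomes, the right-hand sides of the Cauchy-Schwarz bounds add up to half an
    eigenvalue of the common marginal [rho]. *)
Lemma marginal_split (L : finType) (M : L -> op K (bool * bool)%type) (v : L -> bool * bool -> K)
    (rho : op K bool) :
  (forall b, psd (M b)) -> (forall b, max_entangled (v b)) -> hermitian_op rho -> trop rho = 1 ->
  (forall i j, \sum_b \sum_c M b (i, c) (j, c) = rho i j) ->
  exists (E : bool -> bool -> K) (l : bool -> K) (X : L -> bool * bool -> bool -> K),
  [/\ forall n m, \sum_x E n x * (E m x)^* = (n == m)%:R,
      forall x y, \sum_n (E n x)^* * E n y = (x == y)%:R,
      forall x y, rho x y = \sum_n l n * ((E n x)^* * E n y),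
      (forall n, 0 <= l n) /\ \sum_n l n = 1 &
      (forall b u, qform (M b) (spectral_scale E u (v b)) =
                    \sum_k `|\sum_n u n * X b k n| ^+ 2) /\
      (forall n, \sum_b \sum_k `|X b k n| ^+ 2 <= 2^-1 * l n)].
Proof.
move=> pM mv hr trr sM; have [E [l [_ EE EtE rE]]] := spectral_op hr.
have [X hX] := fin_all_exists (fun b => spectral_split (pM b) EE (mv b)).
have lE n : \sum_b \sum_c \sum_i \sum_j E n i * M b (i, c) (j, c) * (E n j)^* = l n.
  transitivity (\sum_i \sum_j E n i * rho i j * (E n j)^* ).
    under eq_bigr => b _ do rewrite exchange_big /=.
    rewrite exchange_big /=; apply: eq_bigr => i _.
    under eq_bigr => b _ do rewrite exchange_big /=.
    rewrite exchange_big /=; apply: eq_bigr => j _.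
    rewrite -sM mulr_sumr mulr_suml; apply: eq_bigr => b _.
    by rewrite mulr_sumr mulr_suml.
  transitivity (\sum_m l m * ((\sum_i E n i * (E m i)^* ) * (\sum_j E m j * (E n j)^* ))).
    under [RHS]eq_bigr => m _ do rewrite big_distrlr /= mulr_sumr.
    rewrite [RHS]exchange_big /=; apply: eq_bigr => i _.
    under [RHS]eq_bigr => m _ do rewrite mulr_sumr.
    rewrite [RHS]exchange_big /=; apply: eq_bigr => j _.
    by rewrite rE mulr_sumr mulr_suml; apply: eq_bigr => m _; ring.
  under eq_bigr => m _ do rewrite !EE.
  rewrite (bigD1 n) //= eqxx !mulr1 big1 ?addr0 // => m /negbTE nm.
  by rewrite nm eq_sym nm !mul0r mulr0.
have le n : \sum_b \sum_k `|X b k n| ^+ 2 <= 2^-1 * l n.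
  rewrite -lE mulr_sumr; apply: ler_sum => b _.
  by have [_ h] := hX b; apply: h.
exists E, l, X; split=> //.
  split=> [n|].
    have p2 : 0 < 2^-1 :> K by rewrite invr_gt0 ltr0n.
    rewrite -(pmulr_rge0 _ p2); apply: le_trans (le n).
    by apply: sumr_ge0 => b _; apply: sumr_ge0 => k _; apply: exprn_ge0.
  rewrite -trr /trop; under [RHS]eq_bigr => x _ do rewrite rE.
  rewrite exchange_big /=; apply: eq_bigr => n _; rewrite -mulr_sumr.
  have := EE n n; rewrite eqxx /= => e; rewrite -[LHS]mulr1 -[1]/(1%:R) -e; congr (_ * _).
  by apply: eq_bigr => x _; rewrite mulrC.
split=> // b u; have [h _] := hX b; exact: h.
Qed.

(** The inequality p |x + y|^2 <= (p + 1) (|x|^2 + p |y|^2), with difference |x - p y|^2, replaces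
    the triangle inequality for norms and keeps square roots out. *)
Lemma eigenvalue_gap (L : finType) (X : L -> bool * bool -> bool -> K) (l : bool -> K) q :
  (forall n, 0 <= l n) -> \sum_n l n = 1 -> 1 / 2 < q ->
  (forall n, \sum_b \sum_k `|X b k n| ^+ 2 <= 2^-1 * l n) ->
  q <= \sum_b \sum_k `|\sum_n X b k n| ^+ 2 ->
  (2 * q - 1) ^+ 2 <= 4 * (l false * l true).
Proof.
move=> l0 l1 q2 hX hq; rewrite big_bool /= addrC in l1.
have [a aE] := realK_ex (ger0_real (l0 false)); have [b bE] := realK_ex (ger0_real (l0 true)).
have rq : q \is Num.real.
  by rewrite -(subrK (1 / 2) q) realD // gtr0_real ?subr_gt0 // divr_gt0 ?ltr01 ?ltr0n.
have [q0 qE] := realK_ex rq.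
have key (p : K) : 0 <= p -> p * q * 2 <= (p + 1) * (l false + p * l true).
  move=> p0.
  have p1 : 0 <= p + 1 by rewrite addr_ge0 ?ler01.
  have pw (x y : K) : p * `|y + x| ^+ 2 <= (p + 1) * (`|x| ^+ 2 + p * `|y| ^+ 2).
    rewrite !normCK -subr_ge0.
    set z := _ - _; have -> : z = (x - p * y) * (x - p * y)^*.
      rewrite /z !rmorphD rmorphN rmorphM /= (CrealP (ger0_real p0)); ring.
    exact: mul_conjC_ge0.
  apply: le_trans (_ : p * (\sum_b \sum_k `|\sum_n X b k n| ^+ 2) * 2 <= _).
    by rewrite ler_wpM2r ?ler0n // ler_wpM2l.
  apply: le_trans (_ : (p + 1) * ((\sum_b \sum_k `|X b k false| ^+ 2) +
     p * (\sum_b \sum_k `|X b k true| ^+ 2)) * 2 <= _).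
    rewrite ler_wpM2r ?ler0n // !mulr_sumr -big_split mulr_sumr; apply: ler_sum => c _.
    rewrite !mulr_sumr -big_split mulr_sumr; apply: ler_sum => k _.
    by rewrite big_bool /=; apply: pw.
  rewrite -mulrA ler_wpM2l // mulrDl lerD //.
    by rewrite -ler_pdivlMr ?ltr0n // mulrC.
  by rewrite -mulrA ler_wpM2l // -ler_pdivlMr ?ltr0n // mulrC.
rewrite -aE -bE -qE.
have := @eigenvalue_product_ge _ a b q0; rewrite -!rval_le /= aE bE.
have ab : a + b = 1 by apply: rval_inj; rewrite rmorphD /= aE bE l1.
move=> /(_ (l0 _) (l0 _) ab); rewrite -aE -bE; apply.
  by rewrite -qE in q2.
by move=> p p0; have := key (rval p) p0; rewrite -aE -bE -qE.
Qed.

End Marginals.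

(** * Gap bound, positivity of the Choi operators, rescaling of a marginal *)

Section Certification.
Variable K : numClosedFieldType.

(** For a + b = 1, 4 q (1 - q) - (a - b)^2 = 4 a b - (2 q - 1)^2. *)
Lemma gap_bound (a b q : K) : 0 <= a -> 0 <= b -> a + b = 1 ->
  (2 * q - 1) ^+ 2 <= 4 * (a * b) -> b <= a ->
  0 <= q * (1 - q) /\ a - b <= 2 * sqrtC (q * (1 - q)).
Proof.
move=> a0 b0 ab h ba.
have e : (a - b) ^+ 2 <= 4 * (q * (1 - q)).
  rewrite -subr_ge0.
  have -> : 4 * (q * (1 - q)) - (a - b) ^+ 2 = 4 * (a * b) - (2 * q - 1) ^+ 2.
    have -> : a = 1 - b by rewrite -ab addrK.
    by ring.
  by rewrite subr_ge0.
have d0 : 0 <= a - b by rewrite subr_ge0.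
have q0 : 0 <= q * (1 - q).
  have p4 : 0 < 4 :> K by rewrite ltr0n.
  by rewrite -(pmulr_rge0 _ p4); apply: le_trans e; apply: exprn_ge0.
split=> //; rewrite -(ler_pXn2r (n := 2)) ?nnegrE ?mulr_ge0 ?ler0n ?sqrtC_ge0 //.
by rewrite exprMn sqrtCK -natrX.
Qed.

Lemma psd_sum (I : finType) (X Y : op K I) : psd X -> psd Y -> psd (fun i j => X i j + Y i j).
Proof.
move=> pX pY v; have := addr_ge0 (pX v) (pY v); congr (0 <= _).
rewrite -big_split; apply: eq_bigr => i _; rewrite -big_split; apply: eq_bigr => j _ /=; ring.
Qed.

Lemma psd_scale (I : finType) (a : K) (X : op K I) : 0 <= a -> psd X -> psd (fun i j => a * X i j).
Proof.
move=> a0 pX v; have := mulr_ge0 a0 (pX v); congr (0 <= _).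
rewrite mulr_sumr; apply: eq_bigr => i _; rewrite mulr_sumr; apply: eq_bigr => j _; ring.
Qed.

Lemma psd_tens (I J : finType) (X : op K I) (Y : op K J) : psd X -> psd Y -> psd (tens X Y).
Proof.
move=> /psd_gram[g gE] /psd_gram[h hE].
apply: (@gram_psd _ _ _ (fun s x => g s.1 x.1 * h s.2 x.2)) => x y.
rewrite /tens gE hE big_distrlr pair_bigA; apply: eq_bigr => s _ /=.
by rewrite rmorphM /=; ring.
Qed.

Lemma spectral_psd (l : bool -> K) (E : bool -> bool -> K) : (forall n, 0 <= l n) ->
  psd (fun x y => \sum_n l n * ((E n x)^* * E n y)).
Proof.
move=> l0; apply: (@gram_psd _ _ _ (fun n x => sqrtC (l n) * E n x)) => x y.
apply: eq_bigr => n _.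
have /ger0_real/CrealP rs : 0 <= sqrtC (l n) by rewrite sqrtC_ge0.
by rewrite rmorphM /= rs mulrACA -expr2 sqrtCK.
Qed.

Lemma swapop_qform (I J : finType) (X : op K (I * J)%type) (v : I * J -> K) :
  qform (swapop X) (fun x => v (x.2, x.1)) = qform X v.
Proof.
rewrite /qform !sum_pair exchange_big; apply: eq_bigr => i _; apply: eq_bigr => j _.
by rewrite !sum_pair exchange_big.
Qed.

Lemma bell_max_entangled_swap b : max_entangled (fun x => @bell_amp K b (x.2, x.1)).
Proof.
have r2 := sqrt2_sqr K; have rn0 : sqrtC (2 : K) != 0 by rewrite sqrtC_eq0 pnatr_eq0.
move=> i j; rewrite big_bool /= !bell_amp_conj.
by case: b i j => -[|[|[|[|//]]]] hb [] []; rewrite /bell_amp /idop /=; field: r2.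
Qed.

Lemma psd_ptr1 (I J : finType) (X : op K (I * J)%type) : psd X ->
  psd (fun i i' => \sum_j X (i, j) (i', j)).
Proof.
move=> /psd_gram[g gE].
apply: (@gram_psd _ _ _ (fun s x => g s.1 (x, s.2))) => x y.
rewrite sum_pair exchange_big /=; apply: eq_bigr => j _; exact: gE.
Qed.

Lemma psd_ptr2 (I J : finType) (X : op K (I * J)%type) : psd X ->
  psd (fun j j' => \sum_i X (i, j) (i, j')).
Proof. by move=> /swapop_psd/psd_ptr1. Qed.

Lemma sum_bool_at (n0 : bool) (F : bool -> K) : \sum_n F n = F n0 + F (~~ n0).
Proof. by rewrite big_bool; case: n0 => //=; rewrite addrC. Qed.

Definition scale_mx (E : bool -> bool -> K) (u : bool -> K) (i j : bool) : K :=
  \sum_n (E n i)^* * u n * E n j.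

(** For real [u] the rescaling is hermitian, so it moves from the state to the vector. *)
Lemma filter_scale_qform (B1 B2 : finType) (s1 : op K (bool * B1)%type)
    (s2 : op K (B2 * bool)%type) X E u (v : bool * bool -> K) :
  (forall n, u n \is Num.real) ->
  qform (steered (filter1 (fun _ : unit => scale_mx E u) s1) s2 X) v =
  qform (steered s1 s2 X) (spectral_scale E u v).
Proof.
move=> ru; set N := scale_mx E u.
have NH i j : (N i j)^* = N j i.
  rewrite /N /scale_mx rmorph_sum; apply: eq_bigr => n _.
  by rewrite !rmorphM /= conjCK (CrealP (ru n)); ring.
have sE x : spectral_scale E u v x = \sum_j N x.1 j * v (j, x.2).
  rewrite /spectral_scale exchange_big; apply: eq_bigr => j _.
  by rewrite mulr_suml.
rewrite (qform_ext _ sE).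
have stE i c j d : steered (filter1 (fun _ : unit => N) s1) s2 X (i, c) (j, d) =
    \sum_p \sum_p' N i p * (N j p')^* * steered s1 s2 X (p, c) (p', d).
  rewrite (@steered_lin1 _ _ _ _ _ _ (bool * bool)%type s1 _ _ _
    (fun s => N i s.1 * (N j s.2)^* ) (fun s => s.1) (fun s => s.2)); first by rewrite sum_pair.
  by move=> m m'; rewrite /filter1 (bigD1 tt) //= [X in _ + X]big1 ?addr0 //; case.
rewrite /qform !sum_pair !big_bool /= !sum_pair !big_bool /= !stE !big_bool /=.
move: (steered s1 s2 X) => S; rewrite !rmorphD !rmorphM /= !NH; ring.
Qed.

End Certification.

(** * The quality bound *)

Section Main.
Variable K : numClosedFieldType.

(** The weights are u = l^(-1/2): the marginal is conjugated by its own inverse square root. *)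
Lemma scale_marginal (B1 : finType) (s1 : op K (bool * B1)%type) (E : bool -> bool -> K)
    (l u : bool -> K) :
  (forall n m, \sum_x E n x * (E m x)^* = (n == m)%:R) ->
  (forall x y, \sum_n (E n x)^* * E n y = (x == y)%:R) ->
  (forall x y, \sum_m s1 (x, m) (y, m) = \sum_n l n * ((E n x)^* * E n y)) ->
  (forall n, u n \is Num.real) -> (forall n, u n ^+ 2 * l n = 1) ->
  forall i j, \sum_m filter1 (fun _ : unit => scale_mx E u) s1 (i, m) (j, m) = idop i j.
Proof.
move=> EE EtE sE ru ul i j; set N := scale_mx E u.
have NE k n : \sum_p N k p * (E n p)^* = (E n k)^* * u n.
  transitivity (\sum_m (m == n)%:R * ((E m k)^* * u m)); last by rewrite sum_delta.
  under eq_bigr => p _ do rewrite /N /scale_mx mulr_suml.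
  rewrite exchange_big; apply: eq_bigr => m _ /=; rewrite -EE mulr_suml.
  by apply: eq_bigr => p _; ring.
rewrite /idop -EtE /filter1 exchange_big (bigD1 tt) //= [X in _ + X]big1 ?addr0; last by case.
rewrite exchange_big /=.
transitivity (\sum_n l n * ((\sum_p N i p * (E n p)^* ) * (\sum_p N j p * (E n p)^* )^* )); last first.
  apply: eq_bigr => n _; rewrite !NE rmorphM /= conjCK (CrealP (ru n)).
  have -> : l n * ((E n i)^* * u n * (E n j * u n)) = (u n ^+ 2 * l n) * ((E n i)^* * E n j) by ring.
  by rewrite ul mul1r.
under [RHS]eq_bigr => n _ do rewrite rmorph_sum big_distrlr pair_bigA mulr_sumr /=.
rewrite [RHS]exchange_big; apply: eq_bigr => p _ /=.
rewrite -mulr_sumr sE mulr_sumr; apply: eq_bigr => n _.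
by rewrite rmorphM /= conjCK; ring.
Qed.

Lemma steered_combine (A B1 B2 C : finType) (t1 : op K (A * B1)%type)
    (t2 t2' : op K (B2 * C)%type) (a : K) X (v : A * C -> K) :
  qform (steered t1 (fun x y => a * t2 x y + t2' x y) X) v =
  a * qform (steered t1 t2 X) v + qform (steered t1 t2' X) v.
Proof.
rewrite /qform mulr_sumr -big_split; apply: eq_bigr => x _.
rewrite mulr_sumr -big_split; apply: eq_bigr => y _ /=; rewrite !steeredE.
have -> : \sum_m \sum_m' X m m' * (t1 (x.1, m'.1) (y.1, m.1) *
   (a * t2 (m'.2, x.2) (m.2, y.2) + t2' (m'.2, x.2) (m.2, y.2))) =
  a * (\sum_m \sum_m' X m m' * (t1 (x.1, m'.1) (y.1, m.1) * t2 (m'.2, x.2) (m.2, y.2))) +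
  \sum_m \sum_m' X m m' * (t1 (x.1, m'.1) (y.1, m.1) * t2' (m'.2, x.2) (m.2, y.2)).
  rewrite mulr_sumr -big_split; apply: eq_bigr => m _.
  by rewrite mulr_sumr -big_split; apply: eq_bigr => m' _ /=; ring.
ring.
Qed.

(* Cross terms cancel, and what remains is [(v^2 - u^2) |y|^2]. *)
Lemma weighted_overlap_ge (u v x y : K) : 0 <= u -> u <= v ->
  u * v * `|x + y| ^+ 2 - (u * v - u ^+ 2) * (`|x| ^+ 2 + `|y| ^+ 2) <= `|u * x + v * y| ^+ 2.
Proof.
move=> u0 uv; have v0 := le_trans u0 uv; rewrite -subr_ge0 !normCK.
set z := _ - _; have -> : z = (v - u) * (v + u) * (y * y^* ).
  by rewrite /z !rmorphD !rmorphM /= (CrealP (ger0_real u0)) (CrealP (ger0_real v0)); ring.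
by rewrite mulr_ge0 ?mul_conjC_ge0 // mulr_ge0 ?subr_ge0 ?addr_ge0.
Qed.

Lemma certify (B1 B2 : finType) (s1 : op K (bool * B1)%type) (s2 : op K (B2 * bool)%type)
    (Bm : 'I_4 -> op K (B1 * B2)%type) (q : K) (etas := 2 * sqrtC (q * (1 - q))) :
  density s1 -> density s2 -> povm Bm -> 1 / 2 < q ->
  q <= \sum_b qform (steered s1 s2 (Bm b)) (bell_amp b) ->
  exists eta : K, 0 <= eta <= etas /\
    quality_ge Bm (@bell K) ((4 * sfun eta * q - tfun eta) / (8 * (1 + etas))).
Proof.
move=> [p1 tr1] [p2 tr2] pB q2 hq.
pose M b := steered s1 s2 (Bm b).
have pM b : psd (M b) by apply: steered_psd => //; case: pB.
pose rA i j := \sum_m s1 (i, m) (j, m); pose rC c d := \sum_m s2 (m, c) (m, d).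
have trA : trop rA = 1 by rewrite -tr1 /trop sum_pair.
have trC : trop rC = 1 by rewrite -tr2 /trop sum_pair exchange_big.
have hA := psd_hermitian (psd_ptr1 p1); have hC := psd_hermitian (psd_ptr2 p2).
have mA i j : \sum_b \sum_c M b (i, c) (j, c) = rA i j.
  rewrite exchange_big /=; under eq_bigr => c _ do rewrite steered_sum //=.
  by rewrite -mulr_sumr -[\sum_(c : bool) _]/(trop rC) trC mulr1.
have mC c d : \sum_b \sum_i swapop (M b) (c, i) (d, i) = rC c d.
  rewrite exchange_big /=; under eq_bigr => i _ do rewrite /swapop steered_sum //=.
  by rewrite -mulr_suml -[\sum_(i : bool) _]/(trop rA) trA mul1r.
have [E [l [X [EE EtE rAE [l0 l1] [XE Xl]]]]] :=
  marginal_split pM (@bell_max_entangled K) hA trA mA.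
have [F [k [Y [_ FtF rCE [k0 k1] [YE Yk]]]]] :=
  marginal_split (fun b => swapop_psd (pM b)) (@bell_max_entangled_swap K) hC trC mC.
have qX : q <= \sum_b \sum_k `|\sum_n X b k n| ^+ 2.
  apply: le_trans hq _; rewrite le_eqVlt; apply/orP; left; apply/eqP; apply: eq_bigr => b _.
  rewrite -/(M b) -(qform_ext _ (fun x => spectral_scale1 (bell_amp b) x EtE)) XE.
  by apply: eq_bigr => i _; under eq_bigr => n _ do rewrite mul1r.
have qY : q <= \sum_b \sum_k `|\sum_n Y b k n| ^+ 2.
  apply: le_trans hq _; rewrite le_eqVlt; apply/orP; left; apply/eqP; apply: eq_bigr => b _.
  rewrite -/(M b) -swapop_qform.
  rewrite -(qform_ext _ (fun x => spectral_scale1 (fun x => bell_amp b (x.2, x.1)) x FtF)) YE.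
  by apply: eq_bigr => i _; under eq_bigr => n _ do rewrite mul1r.
have gX := eigenvalue_gap l0 l1 q2 Xl qX; have gY := eigenvalue_gap k0 k1 q2 Yk qY.
have maxE (f : bool -> K) : (forall n, 0 <= f n) -> exists n0, f (~~ n0) <= f n0.
  move=> f0; have [h|h] := real_leP (ger0_real (f0 false)) (ger0_real (f0 true)).
    by exists true.
  by exists false; apply: ltW.
have prodE (f : bool -> K) n0 : f false * f true = f n0 * f (~~ n0).
  by case: n0 => //=; rewrite mulrC.
have [n0 ln] := maxE l l0; have [m0 km] := maxE k k0.
rewrite (sum_bool_at n0) in l1; rewrite (sum_bool_at m0) in k1.
rewrite (prodE l n0) in gX; rewrite (prodE k m0) in gY.
have [qq etaX] := gap_bound (l0 _) (l0 _) l1 gX ln.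
have [_ etaY] := gap_bound (k0 _) (k0 _) k1 gY km.
have es0 : 0 <= etas by rewrite mulr_ge0 ?ler0n ?sqrtC_ge0.
set a := l n0 in l1 gX etaX ln; set b := l (~~ n0) in l1 gX etaX ln.
(* The witness is the spectral gap of the A marginal. *)
exists (a - b); split; first by rewrite subr_ge0 ln.
have two0 : 0 < 2 :> K by rewrite ltr0n.
(* q > 1/2 makes the left side of [gX] positive, so the marginal is invertible. *)
have ab0 : 0 < a * b.
  have p4 : 0 < 4 :> K by rewrite ltr0n.
  rewrite -(pmulr_rgt0 _ p4); apply: lt_le_trans gX.
  by rewrite exprn_gt0 // subr_gt0 -ltr_pdivrMl // mulrC.
have a0 : 0 < a by rewrite lt0r l0 andbT; apply/eqP => e; rewrite e mul0r ltxx in ab0.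
have b0 : 0 < b by rewrite lt0r l0 andbT; apply/eqP => e; rewrite e mulr0 ltxx in ab0.
have lp n : 0 < l n.
  by case: (altP (n =P n0)) => [-> //|];
     case: n n0 @a @b a0 b0 {ln l1 gX etaX ab0} => [] [].
pose u n := (sqrtC (l n))^-1.
have u0 n : 0 < u n by rewrite invr_gt0 sqrtC_gt0.
have ru n : u n \is Num.real by rewrite gtr0_real.
have ul n : u n ^+ 2 * l n = 1 by rewrite exprVn sqrtCK mulVf ?gt_eqF.
have e1 : 0 < 1 + etas by rewrite ltr_wpDr ?ltr01.
(* The larger eigenvalue of the C marginal is half of 1 plus its gap, so at most (1 + etas) / 2;
   this c keeps c times the marginal below the identity. *)
pose c := 2 / (1 + etas); have c0 : 0 <= c by rewrite divr_ge0 ?ler0n ?ltW.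
have ck n : 0 <= 1 - c * k n.
  rewrite subr_ge0 /c mulrAC ler_pdivrMr // mul1r.
  have km0 : 2 * k m0 <= 1 + etas.
    by rewrite -[X in _ <= X + _]k1 mulr2n mulrDl mul1r -lerBlDl; apply: le_trans etaY;
       rewrite opprD addrACA subrr add0r.
  case: (altP (n =P m0)) => [-> //| nm]; apply: le_trans km0; rewrite ler_wpM2l ?(ltW two0) //.
  by have -> : n = ~~ m0 by case: (n) (m0) nm => [] [].
(* The noise is the B2 marginal [om], of trace 1, tensored with [G], which completes c times the C
   marginal to the identity. *)
pose om x y := \sum_c s2 (x, c) (y, c).
pose G x y := \sum_n (1 - c * k n) * ((F n x)^* * F n y).
have GE x y : G x y = idop x y - c * rC x y.
  rewrite /G /idop -FtF /rC rCE mulr_sumr -sumrB; apply: eq_bigr => n _; ring.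
pose k1op := filter1 (fun _ : unit => scale_mx E u) s1.
pose k2op x y := c * s2 x y + tens om G x y.
have pk1 : psd k1op by apply: filter1_psd.
have pomG : psd (tens om G) by apply: psd_tens; [apply: psd_ptr1 | apply: spectral_psd].
have pk2 : psd k2op by apply: psd_sum => //; apply: psd_scale.
exists (chan k1op), (chan (swapop k2op)).
split; first exact: chan_cp.
split; first by apply: chan_unital; apply: scale_marginal EE EtE rAE ru ul.
split; first by apply/chan_cp/swapop_psd.
split.
  apply: chan_unital => i j; rewrite /swapop /k2op /tens big_split /= -mulr_sumr -mulr_suml.
  have -> : \sum_i0 om i0 i0 = 1 by rewrite -tr2 /trop sum_pair.
  by rewrite mul1r GE addrC subrK.
rewrite quality_steered.
(* The noise contributes a nonnegative term, dropped here. *)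
apply: le_trans (_ : (2 * 2)^-1 * (c * \sum_b \sum_k `|\sum_n u n * X b k n| ^+ 2) <= _); last first.
  rewrite ler_wpM2l ?invr_ge0 ?mulr_ge0 ?ler0n // mulr_sumr; apply: ler_sum => i _.
  rewrite steered_combine filter_scale_qform // -/(M i) XE lerDl.
  by apply: steered_psd => //; case: pB.
(* With eta = a - b, the product of the weights is 1 / sqrt (a b) = s(eta) and [u n0 ^+ 2] is 1 / a
   = 2 / (1 + eta), so this is c (s(eta) q - t(eta) / 4) / 4. *)
apply: le_trans (_ : (2 * 2)^-1 * (c * (u n0 * u (~~ n0) * q -
    (u n0 * u (~~ n0) - u n0 ^+ 2) * 2^-1)) <= _).
  rewrite le_eqVlt; apply/orP; left; apply/eqP.
  pose SA := sqrtC a; pose SB := sqrtC b.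
  have A0 : 0 < SA by rewrite sqrtC_gt0.
  have B0 : 0 < SB by rewrite sqrtC_gt0.
  have SA2 : SA ^+ 2 = a by rewrite sqrtCK.
  have SB2 : SB ^+ 2 = b by rewrite sqrtCK.
  have sE : sqrtC (1 - (a - b) ^+ 2) = 2 * SA * SB.
    rewrite -[RHS]sqrCK; last by rewrite !mulr_ge0 // ltW.
    congr sqrtC; rewrite !exprMn SA2 SB2.
    have -> : a = 1 - b by rewrite -l1 addrK.
    by ring.
  have tE : 1 + (a - b) = 2 * SA ^+ 2.
    by rewrite SA2 (_ : b = 1 - a); [ring | rewrite -l1 addrC addKr].
  rewrite /sfun /tfun sE tE /c /u -/a -/b -/SA -/SB.
  have nA : SA != 0 by rewrite gt_eqF.
  have nB : SB != 0 by rewrite gt_eqF.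
  have ne : 1 + etas != 0 by rewrite gt_eqF.
  move: SA SB etas nA nB ne {A0 B0 SA2 SB2 sE tE es0 etaX etaY e1 c c0 ck G GE k2op pomG pk2}.
  move=> SA SB etas nA nB ne.
  by field; rewrite nA nB ne.
rewrite ler_wpM2l ?invr_ge0 ?mulr_ge0 ?ler0n // ler_wpM2l //.
have uv : u n0 <= u (~~ n0).
  by rewrite lef_pV2 ?posrE ?sqrtC_gt0 // ler_sqrtC ?nnegrE ?l0.
apply: le_trans (_ : u n0 * u (~~ n0) * (\sum_b \sum_k `|\sum_n X b k n| ^+ 2) -
   (u n0 * u (~~ n0) - u n0 ^+ 2) * (\sum_b \sum_k (`|X b k n0| ^+ 2 + `|X b k (~~ n0)| ^+ 2)) <= _).
  apply: lerB.
    by rewrite ler_wpM2l // mulr_ge0 // ltW.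
  have w0 : 0 <= u n0 * u (~~ n0) - u n0 ^+ 2.
    by rewrite expr2 -mulrBr mulr_ge0 ?subr_ge0 // ltW.
  rewrite ler_wpM2l //.
  under eq_bigr => i _ do rewrite big_split /=.
  rewrite big_split /= -[2^-1]mulr1 -[X in _ * X]l1 mulrDr; apply: lerD; exact: Xl.
rewrite !mulr_sumr -sumrB; apply: ler_sum => i _.
rewrite !mulr_sumr -sumrB; apply: ler_sum => j _.
rewrite !(sum_bool_at n0); apply: weighted_overlap_ge => //; exact: ltW.
Qed.

End Main.

(** A lower bound by the value at one eta of the interval implies the one by the minimum. The
    filters act on A and C only, so the channels built from the filtered sources certify the
    original measurement. *)
Theorem theorem2 (K : numClosedFieldType) (A B1 B2 C : finType)
  (tAB1 : op K (A * B1)%type) (tB2C : op K (B2 * C)%type)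
  (Bm : 'I_4 -> op K (B1 * B2)%type)
  (A0 A1 : op K A) (C0 C1 : op K C) :
  density tAB1 -> density tB2C -> povm Bm ->
  observable A0 -> observable A1 -> observable C0 -> observable C1 ->
  let tau := prod_state tAB1 tB2C in
  let bave := beta_ave tau Bm A0 A1 C0 C1 in
  xstar < bave ->
  let q := gfun bave in
  let etas := 2 * sqrtC (q * (1 - q)) in
  (* Q(B, Phi) >= min_{eta in [0, etas]} (4 s(eta) q - t(eta)) / (8 (1 + etas)) *)
  exists eta : K, 0 <= eta <= etas /\
    quality_ge Bm (@bell K) ((4 * sfun eta * q - tfun eta) / (8 * (1 + etas))).
Proof.
move=> d1 d2 pB hA0 hA1 hC0 hC1 tau bave hb q etas.
have [N [N' [T [T' [iT iT' hq]]]]] := filtered_fidelity d1 d2 pB hA0 hA1 hC0 hC1.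
rewrite -gfunE in hq.
have [p1 tr1] := d1; have [p2 tr2] := d2.
apply: (@certify K B1 B2 (filter1 T tAB1) (filter2 T' tB2C)) => //.
- by split; [apply: filter1_psd | rewrite filter1_trace].
- by split; [apply: filter2_psd | rewrite filter2_trace].
(* q > 1/2 because x* < 2 sqrt 2, that is 16 < 20 sqrt 2. *)
rewrite /q /gfun ltrDl mulr_gt0 ?divr_gt0 ?ltr01 ?ltr0n ?subr_gt0 //.
rewrite /xstar ltr_pdivrMr ?ltr0n //.
have [r0 <- [r00 r02]] := sqrt2_real K; have /andP[r1 _] := sqrt2_bounds r00 r02.
by change (16 + 14 * r0 < 2 * r0 * 17); lra.
Qed.
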